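(* For every sufficiently large natural number $n$ there exists a non-amenable group $H$ with $n\leq \mathcal{T}(H)\leq 2n$.
   Context: A group $G$ admits a paradoxical decomposition if there exist positive integers $m,k$, pairwise disjoint subsets $P_1,\ldots,P_m,Q_1,\ldots,Q_k$ of $G$ and elements $g_1,\ldots,g_m,h_1,\ldots,h_k\in G$ such that $G=\bigcup_{i=1}^m P_ig_i=\bigcup_{j=1}^k Q_jh_j$; this happens if and only if $G$ is non-amenable. For a non-amenable group $G$, the Tarski number $\mathcal{T}(G)$ is the minimal value of $m+k$ over all paradoxical decompositions of $G$. *)

(* Defs.v *)
From Stdlib Require Import Reals.
Open Scope R_scope.

Record Group : Type := {
  carrier :> Type;
  gmul : carrier -> carrier -> carrier;
  gone : carrier;
  ginv : carrier -> carrier;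
  gmul_assoc : forall x y z, gmul x (gmul y z) = gmul (gmul x y) z;
  gmul_one_l : forall x, gmul gone x = x;
  gmul_one_r : forall x, gmul x gone = x;
  gmul_inv_l : forall x, gmul (ginv x) x = gone;
  gmul_inv_r : forall x, gmul x (ginv x) = gone
}.

Definition amenable (G : Group) : Prop :=
  exists mu : (G -> Prop) -> R,
    (forall A, 0 <= mu A) /\
    mu (fun _ => True) = 1 /\
    (forall A B, (forall x, A x -> B x -> False) ->
                 mu (fun x => A x \/ B x) = mu A + mu B) /\
    (forall (g : G) A, mu (fun x => A (gmul G (ginv G g) x)) = mu A).

Definition non_amenable (G : Group) : Prop := ~ amenable G.

Definition paradoxical_decomposition (G : Group) (m k : nat) : Prop :=
  (0 < m)%nat /\ (0 < k)%nat /\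
  exists (P Q : nat -> G -> Prop) (g h : nat -> G),
    (forall i i' x, (i < m)%nat -> (i' < m)%nat -> i <> i' -> P i x -> P i' x -> False) /\
    (forall j j' x, (j < k)%nat -> (j' < k)%nat -> j <> j' -> Q j x -> Q j' x -> False) /\
    (forall i j x, (i < m)%nat -> (j < k)%nat -> P i x -> Q j x -> False) /\
    (forall x : G, exists i y, (i < m)%nat /\ P i y /\ x = gmul G y (g i)) /\
    (forall x : G, exists j y, (j < k)%nat /\ Q j y /\ x = gmul G y (h j)).

Definition is_tarski_number (G : Group) (t : nat) : Prop :=
  (exists m k, paradoxical_decomposition G m k /\ m + k = t)%nat /\
  (forall m k, paradoxical_decomposition G m k -> (t <= m + k)%nat).

(* Main.v *)
(** Golod's construction yields a graded algebra R over F_2 on 16 letters in which,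
    for every j, any 4^j elements of R_{>= j} generate a nilpotent subalgebra, and
    after division by the elements annihilated by some R_+^n no nonzero element of
    R is annihilated by all letters on the left.  Let G_j = 1 + M_2(R_{>= j}).

    G_1 acts paradoxically on the nonzero pairs (x, y): if deg x <= deg y, choose a
    word w of length 1 or 2 with deg (w y) = deg y + |w| and send (x, y) to
    (x + w y, y), otherwise exchange the roles of x and y.  Degrees reveal the case
    and |w|, hence w, so this embeds two disjoint copies of the set into itself.

    In G_j any 4^(j-1) elements generate a finite group, so a paradoxical
    decomposition of G_j has more than 4^(j-1) pieces.  Finally G_j is a
    2-group over G_{j+1}, so the G_j are joined by subgroups of successive index 2,
    along which the Tarski number at most doubles; the first one in this chain
    whose Tarski number reaches n has Tarski number at most 2 n. *)

Require Import Defs.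
From Stdlib Require Import Reals.
From Stdlib Require List FinFun Lra.
From HB Require Import structures.
From mathcomp Require all_boot all_algebra generic_quotient boolp zify.

Module TarskiNumbers.
Import all_boot all_algebra generic_quotient boolp zify.

Set Implicit Arguments.
Unset Strict Implicit.
Unset Printing Implicit Defensive.
Local Open Scope nat_scope.

Delimit Scope R_scope with coqR.

(** * Paradoxical decompositions as pairs of piecewise translations *)

(* If x lies in P_i g_i then f true x = x g_i^-1 is its preimage in P_i, and
   similarly f false for the pieces Q_j. *)
Definition paradox (G : Defs.Group) (m : bool -> nat) : Prop :=
  exists (s : bool -> nat -> G) (f : bool -> G -> G),
    (forall b x, exists i, i < m b /\ f b x = gmul G x (s b i)) /\
    (forall b b' x x', f b x = f b' x' -> b = b' /\ x = x').

Section Group_facts.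
Variable G : Defs.Group.
Notation "x ** y" := (gmul G x y) (at level 40, left associativity).
Notation "x ^i" := (ginv G x) (at level 3).

Lemma gmulK x y : x ** y ** y^i = x.
Proof. by rewrite -gmul_assoc gmul_inv_r gmul_one_r. Qed.
Lemma gmulI x y z : x ** y = x ** z -> y = z.
Proof.
move=> e; rewrite -(gmul_one_l G y) -(gmul_inv_l G x) -gmul_assoc e.
by rewrite gmul_assoc gmul_inv_l gmul_one_l.
Qed.
Lemma gmulIr x y z : y ** x = z ** x -> y = z.
Proof. by move=> e; rewrite -(gmulK y x) e gmulK. Qed.
Lemma ginvM x y : (x ** y)^i = y^i ** x^i.
Proof. by apply: (@gmulI (x ** y)); rewrite gmul_inv_r gmul_assoc gmulK gmul_inv_r. Qed.
Lemma ginvK x : (x^i)^i = x.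
Proof. by apply: (@gmulI x^i); rewrite gmul_inv_r gmul_inv_l. Qed.

Lemma paradox_of_decomposition m k :
  paradoxical_decomposition G m k -> paradox G (fun b => if b then m else k).
Proof.
move=> [m0 [k0 [P [Q [g [h [dP [dQ [dPQ [cP cQ]]]]]]]]]].
have /choice [i1 i1P] : forall x, exists i, i < m /\ P i (x ** (g i)^i).
  move=> x; have [i [y [ltim [Py ->]]]] := cP x.
  by exists i; split; [exact/ltP|rewrite gmulK].
have /choice [i2 i2P] : forall x, exists i, i < k /\ Q i (x ** (h i)^i).
  move=> x; have [i [y [ltim [Py ->]]]] := cQ x.
  by exists i; split; [exact/ltP|rewrite gmulK].
exists (fun b i => if b then (g i)^i else (h i)^i).
exists (fun b x => x ** (if b then (g (i1 x))^i else (h (i2 x))^i)).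
split=> [[] x|].
- by exists (i1 x); have [] := i1P x.
- by exists (i2 x); have [] := i2P x.
move=> b b' x x' e.
have [/ltP a1 p1] := i1P x; have [/ltP a1' p1'] := i1P x'.
have [/ltP a2 p2] := i2P x; have [/ltP a2' p2'] := i2P x'.
case: b b' e => [] [] e; rewrite ?e in p1 p2.
- have [ei|ne] := pselect (i1 x = i1 x'); last by case: (dP _ _ _ a1 a1' ne p1 p1').
  by rewrite ei in e; move/gmulIr: e.
- by case: (dPQ _ _ _ a1 a2' p1 p2').
- by case: (dPQ _ _ _ a1' a2 p1' p2).
- have [ei|ne] := pselect (i2 x = i2 x'); last by case: (dQ _ _ _ a2 a2' ne p2 p2').
  by rewrite ei in e; move/gmulIr: e.
Qed.

(** The piece [D b j] is the image under [f b] of the points that use translation [j]; joint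
    injectivity of [f] in both arguments makes these pieces disjoint. *)
Lemma decomposition_of_paradox m :
  paradox G m -> paradoxical_decomposition G (m true) (m false).
Proof.
move=> [s [f [fs finj]]].
have [i iP] : exists i : bool -> G -> nat, forall b x, i b x < m b /\ f b x = x ** s b (i b x).
  have /choice [i iP] : forall bx : bool * G, exists i,
    i < m bx.1 /\ f bx.1 bx.2 = bx.2 ** s bx.1 i by case=> b x; exact: fs.
  by exists (fun b x => i (b, x)) => b x; exact: (iP (b, x)).
have m_gt0 b : (0 < m b)%coq_nat.
  by apply/ltP; case: (iP b (gone G)) => + _; exact: leq_ltn_trans.
pose D b j y := exists x, i b x = j /\ y = f b x.
have cov b x : exists j y, (j < m b)%coq_nat /\ D b j y /\ x = y ** (s b j)^i.
  exists (i b x), (f b x); split; first by apply/ltP; case: (iP b x).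
  by split; [exists x|rewrite (iP b x).2 gmulK].
have dis b j j' x : (j < m b)%coq_nat -> (j' < m b)%coq_nat -> j <> j' ->
    D b j x -> D b j' x -> False.
  by move=> _ _ ne [y [ej ->]] [y' [ej' /finj[_ ey]]]; apply: ne; rewrite -ej -ej' ey.
split; first exact: m_gt0; split; first exact: m_gt0.
exists (D true), (D false), (fun j => (s true j)^i), (fun j => (s false j)^i).
split; first exact: dis; split; first exact: dis; split; last by split; exact: cov.
by move=> j j' x _ _ [y [_ ->]] [y' [_ /finj []]].
Qed.

(** * Paradoxes exclude invariant means *)

Section Mean.
Local Open Scope R_scope.
Variable nu : (G -> Prop) -> R.
Hypothesis nuD : forall A B, (forall x, A x -> B x -> False) ->
  nu (fun x => A x \/ B x) = nu A + nu B.
Hypothesis nuR : forall (g : G) A, nu (fun x => A (x ** g)) = nu A.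

(** Induction on the number of translations: on the points with [i x = n] the map is a single right
    translation, and injectivity keeps its image disjoint from the rest. *)
Lemma mean_injection (n : nat) (s : nat -> G) (i : G -> nat) (f : G -> G) (A : G -> Prop) :
    (forall x y, f x = f y -> x = y) -> (forall x, f x = x ** s (i x)) ->
    (forall x, A x -> i x < n)%N ->
  nu (fun y => exists x, A x /\ y = f x) = nu A.
Proof.
move=> finj fE; elim: n A => [|n IHn] A ltin.
  by congr nu; apply/funext => y; apply/propext; split=> [[x [/ltin]]|/ltin].
pose A1 x := A x /\ i x <> n; pose A2 x := A x /\ i x = n.
have -> : A = (fun x => A1 x \/ A2 x).
  apply/funext => x; apply/propext; rewrite /A1 /A2; split=> [Ax|]; last by tauto.
  by case: (pselect (i x = n)); tauto.
rewrite [RHS]nuD; last by rewrite /A1 /A2; tauto.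
rewrite -[nu A1]IHn; last first.
  by move=> x [/ltin]; rewrite ltnS leq_eqVlt => /orP [/eqP|].
have -> : nu A2 = nu (fun y => exists x, A2 x /\ y = f x).
  rewrite -(nuR (s n) (fun y => exists x, _)); congr nu; apply/funext => x; apply/propext.
  split=> [[Ax ix]|[x' [[Ax' ix'] e]]]; first by exists x; rewrite fE ix.
  by rewrite fE ix' in e; move/gmulIr: e => ->.
rewrite -nuD; last by move=> y [x [[_ nx] ->]] [x' [[_ nx'] /finj e]]; rewrite e in nx.
congr nu; apply/funext => y; apply/propext; split=> [[x [[A1x|A2x] ->]]|].
- by left; exists x.
- by right; exists x.
- by case=> [] [x [Ax ->]]; exists x; tauto.
Qed.

End Mean.

(** The disjoint images of [f true] and [f false] would each have mean 1 inside a space of mean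
    1. *)
Lemma paradox_non_amenable m : paradox G m -> non_amenable G.
Proof.
move=> [s [f [fs finj]]] [mu [mu_ge0 [muT [muD muL]]]].
(* The mean in [amenable] is left invariant, while pieces move by right translations; inversion
   exchanges the two sides. *)
pose nu A := mu (fun x => A x^i).
have nuD A B : (forall x, A x -> B x -> False) ->
    nu (fun x => A x \/ B x) = (nu A + nu B)%coqR.
  by move=> dAB; rewrite /nu muD // => x; exact: dAB.
have nuR g A : nu (fun x => A (x ** g)) = nu A.
  by rewrite /nu -(muL g (fun x => A x^i)); congr mu; apply/funext => x; rewrite ginvM ginvK.
have imf b : nu (fun y => exists x, True /\ y = f b x) = 1%coqR.
  have /choice [i iP] := fs b.
  rewrite (@mean_injection nu nuD nuR (m b) (s b) i (f b) (fun=> True)) => //.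
  - by move=> x y /finj [].
  - by move=> x; case: (iP x).
  - by move=> x _; case: (iP x).
pose B y := exists b x, y = f b x.
have nuB : nu B = (1 + 1)%coqR.
  rewrite -{1}(imf true) -(imf false) -nuD; last first.
    by move=> _ [x [_ ->]] [x' [_ /finj []]].
  congr nu; apply/funext => y; apply/propext; split=> [[[] [x ->]]|].
  - by left; exists x.
  - by right; exists x.
  - by case=> [] [x [_ ->]]; [exists true, x|exists false, x].
have : nu (fun x => B x \/ ~ B x) = 1%coqR.
  by rewrite -muT; congr mu; apply/funext => x; apply/propext; split=> // _; exact: EM.
rewrite nuD; last by move=> x Bx; apply.
have := mu_ge0 (fun x => ~ B x^i); rewrite -/(nu (fun x => ~ B x)) nuB.
by Lra.lra.
Qed.

(** With at most [k] translations, some nonempty finite [K] would be stable under all of them, and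
    [f true], [f false] would embed two disjoint copies of [K] into [K]. *)
Lemma paradox_size_gt m k :
    (forall S : seq G, size S <= k -> exists K : seq G, K <> [::] /\
       forall x t, List.In x K -> List.In t S -> List.In (x ** t) K) ->
  paradox G m -> k < m true + m false.
Proof.
move=> finK [s [f [fs finj]]]; rewrite ltnNge; apply/negP => lemk.
pose S := [seq s true i | i <- iota 0 (m true)] ++ [seq s false i | i <- iota 0 (m false)].
have [|K [K0 Kstable]] := finK S; first by rewrite size_cat !size_map !size_iota.
have inS b i : i < m b -> List.In (s b i) S.
  have inI n a j : j < n -> List.In (a + j) (iota a n).
    elim: n a j => // n IHn a [|j] lt; first by rewrite addn0; left.
    by right; rewrite addnS -addSn; exact: IHn.
  move=> ltim; apply/List.in_or_app; case: b ltim => ltim; [left|right].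
    exact/List.in_map/(inI _ 0).
  exact/List.in_map/(inI _ 0).
pose L := List.nodup (fun x y : G => pselect (x = y)) K.
have NL : List.NoDup L by exact: List.NoDup_nodup.
have inL x : List.In x L <-> List.In x K by exact: List.nodup_In.
have := @List.NoDup_incl_length _ (List.app (List.map (f true) L) (List.map (f false) L)) L.
rewrite List.length_app !List.length_map => le2; suff : L = [::].
  by case: (K) K0 inL => // x K1 _ inL L0; case: (inL x) => _; rewrite L0 /=; apply; left.
apply/List.length_zero_iff_nil; suff /leP le2' : (List.length L + List.length L)%coq_nat <= List.length L.
  by move: le2'; case: (List.length L) => // n; rewrite plusE addnS => /leP; rewrite ltnNge leq_addr.
apply/leP/le2.
- apply/List.NoDup_app; first by apply: FinFun.Injective_map_NoDup => // x y /finj [].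
  + by apply: FinFun.Injective_map_NoDup => // x y /finj [].
  + by move=> y /List.in_map_iff [x [<- _]] /List.in_map_iff [x' [/finj [] ]].
- have fL b y : List.In y (List.map (f b) L) -> List.In y L.
    move=> /List.in_map_iff [x [<- /inL xK]]; apply/inL.
    have [i [ltim ->]] := fs b x; exact: Kstable xK (inS _ _ ltim).
  by move=> y /List.in_app_iff [] /fL.
Qed.
End Group_facts.

(** * Two-colourings alternating along two involutions *)

Section Two_coloring.
Variables (E : Type).
Variables (sg ta : E -> E).
Hypotheses (sgK : involutive sg) (taK : involutive ta).
Hypotheses (sg_neq : forall e, sg e <> e) (ta_neq : forall e, ta e <> e).
Let r e := ta (sg e).
(* sg and ta generate a dihedral group in which no reflection has a fixed point,
   since reflections are conjugate to sg or to ta; so its rotations have two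
   orbits on each component, exchanged by sg and by ta. *)
Let same e e' := exists k, e' = iter k r e \/ e = iter k r e'.

Let iter_neq k e : iter k r e <> sg e.
Proof.
elim/ltn_ind: k e => -[|[|k]] IHk e /=; first by move=> /esym /sg_neq.
  by move=> /ta_neq.
(* An equality at exponent [k.+2] for [e] becomes one at exponent [k] for [r e], because [sg] and
   [ta] invert [r]. *)
move=> h; apply: (IHk k (leqnSn _) (r e)).
by rewrite -[LHS]sgK; congr sg; rewrite -[LHS]taK -/(r _) -iterSr /= h.
Qed.

Let same_refl e : same e e. Proof. by exists 0; left. Qed.
Let same_sym e e' : same e e' -> same e' e.
Proof. by move=> [k [|]]; exists k; [right|left]. Qed.
Let r_inj : injective r. Proof. exact: inj_comp (can_inj taK) (can_inj sgK). Qed.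
Let same_trans e e' e'' : same e e' -> same e' e'' -> same e e''.
Proof.
have iter_inj k : injective (iter k r) by elim: k => // k IHk x y /= /r_inj /IHk.
move=> [k [->|->]] [l [->|]].
- by exists (l + k); left; rewrite iterD.
- case: (leqP k l) => [/subnKC <-|/ltnW /subnKC <-]; rewrite iterD => /iter_inj e1.
    by exists (l - k); right.
  by exists (k - l); left.
- case: (leqP k l) => [/subnKC <-|/ltnW /subnKC <-].
    by exists (l - k); left; rewrite addnC iterD.
  by exists (k - l); right; rewrite addnC iterD.
- by move=> ->; exists (k + l); right; rewrite iterD.
Qed.
Let same_sg e e' : same e e' -> same (sg e) (sg e').
Proof.
have sg_iter k x : sg x = iter k r (sg (iter k r x)).
  by elim: k x => // k IHk x; rewrite iterSr /= {2}/r sgK taK -IHk.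
move=> [k [->|->]]; first by exists k; right; exact: sg_iter.
by exists k; left; exact: sg_iter.
Qed.
Let not_same_sg e : ~ same e (sg e).
Proof. by move=> [k [/esym /iter_neq //|]]; rewrite -{1}[e]sgK => /esym/iter_neq. Qed.

Lemma two_coloring_total : exists c : E -> bool,
  (forall e, c (sg e) = ~~ c e) /\ (forall e, c (ta e) = ~~ c e).
Proof.
pose Q e e' := same e e' \/ same e (sg e').
have Q_refl e : Q e e by left.
have same_sgr e e' : same e (sg e') <-> same (sg e) e'.
  by split=> /same_sg; rewrite sgK.
have Qsg e : Q (sg e) = Q e.
  apply/funext => e'; apply/propext; rewrite /Q.
  have := same_sgr e e'; have : same (sg e) (sg e') <-> same e e'; last by tauto.
  by split=> /same_sg; rewrite ?sgK.
have Qsame e e' : same e e' -> Q e = Q e'.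
  move=> ee'; apply/funext => x; apply/propext; rewrite /Q.
  by split=> -[] ex; [left|right|left|right]; apply: same_trans ex => //; exact: same_sym.
(* [F] chooses from the predicate and not from the point, so all points of one component receive the
   same representative. *)
have /choice [F FP] : forall P : E -> Prop, exists o,
    (exists y, P y) -> exists y, o = Some y /\ P y.
  move=> P; have [[y Py]|nP] := pselect (exists y, P y); last by exists None => /nP.
  by exists (Some y) => _; exists y.
have rep e : exists y, F (Q e) = Some y /\ Q e y by apply: FP; exists e.
exists (fun e => `[< exists y, F (Q e) = Some y /\ same y e >]).
suff key : forall e e', same e' (sg e) ->
    `[< exists y, F (Q e') = Some y /\ same y e' >] =
    ~~ `[< exists y, F (Q e) = Some y /\ same y e >].
  split=> e; apply: key; first exact: same_refl.
  by apply: same_sym; exists 1; left; rewrite /= /r sgK.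
move=> e e' ee'; rewrite (Qsame _ _ ee') Qsg -asbool_neg; apply: asbool_equiv_eq.
have [y [-> Qy]] := rep e; split=> [[y' [[<-] ye']] [y'' [[<-] ye]]|ny].
  by apply: (@not_same_sg e); apply: same_trans (same_sym ye) _; apply: same_trans ye' ee'.
exists y; split=> //; apply: same_trans (same_sym ee').
by case: Qy => [ey|/same_sgr /same_sym //]; case: ny; exists y; split=> //; exact: same_sym.
Qed.
End Two_coloring.

Lemma two_coloring (E : Type) (sg : E -> E) (mate : E -> E -> Prop) :
    involutive sg -> (forall e, sg e <> e) ->
    (forall x y, mate x y -> mate y x) -> (forall x, ~ mate x x) ->
    (forall x y z, mate x y -> mate x z -> y = z) ->
  exists c : E -> bool,
    (forall e, c (sg e) = ~~ c e) /\ (forall x y, mate x y -> c y = ~~ c x).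
Proof.
move=> sgK sg_neq mateC mate_irr mate_fun.
have /choice [p pP] : forall x, exists o : option E,
    if o is Some y then mate x y else forall y, ~ mate x y.
  move=> x; have [[y xy]|nx] := pselect (exists y, mate x y); first by exists (Some y).
  by exists None => y xy; apply: nx; exists y.
have pE x y : mate x y -> p x = Some y.
  move=> xy; have := pP x; case: (p x) => [z /mate_fun/(_ xy) ->//|nx].
  by case: (nx y).
(* Two copies of E are glued along the elements without a mate, so that both
   involutions become total. *)
pose ta (x : E * bool) := if p x.1 is Some y then (y, x.2) else (x.1, ~~ x.2).
have taK : involutive ta.
  case=> x b; rewrite /ta /=; have := pP x; case px: (p x) => [y|] /= => [xy|_].
    by rewrite (pE _ _ (mateC _ _ xy)).
  by rewrite px negbK.
have [||||c [csg cta]] := @two_coloring_total (E * bool) (fun x => (sg x.1, x.2)) ta.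
- by case=> x b /=; rewrite sgK.
- exact: taK.
- by case=> x b [] /sg_neq.
- case=> x b; rewrite /ta /=; have := pP x; case: (p x) => [y|] /= => [xy|_].
    by case=> eyx; move: xy; rewrite eyx => /mate_irr.
  by case; case: b.
exists (fun x => c (x, true)); split=> [e|x y xy]; first exact: (csg (e, true)).
by have := cta (x, true); rewrite /ta /= (pE _ _ xy).
Qed.

(* Two half-edges leave each copy of each k : K, and two arrive at each k : K.
   A choice of one half-edge per source with distinct targets is a colour class
   of a 2-colouring of the half-edges. *)
Lemma paradox_index2 (K L : Defs.Group) (h : K -> L) (u : L) (m : bool -> nat) :
    (forall x y, h (gmul K x y) = gmul L (h x) (h y)) -> injective h ->
    (forall x, h x <> u) ->
    (forall x, exists k (e : bool), x = gmul L (h k) (if e then u else gone L)) ->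
  paradox L m -> paradox K (fun b => 2 * m b).
Proof.
move=> hM h_inj hu cov [s [f [fs finj]]].
pose ue (e : bool) := if e then u else gone L.
have h1 : h (gone K) = gone L.
  by apply: (@gmulI L (h (gone K))); rewrite -hM !gmul_one_r.
have hV x : h (ginv K x) = ginv L (h x).
  by apply: (@gmulI L (h x)); rewrite -hM !gmul_inv_r.
have dec_uniq k k' e e' : gmul L (h k) (ue e) = gmul L (h k') (ue e') -> (k, e) = (k', e').
  have hu' x y z : gmul L (h x) u = gmul L (h y) (h z) -> False.
    move=> E; apply: (hu (gmul K (gmul K (ginv K x) y) z)).
    by apply: (@gmulI L (h x)); rewrite E !hM hV !gmul_assoc gmul_inv_r gmul_one_l.
  by case: e e' => [] [] /=; rewrite -?h1;
    [move=> /gmulIr/h_inj ->|move/hu'|move/esym/hu'|move=> /gmulIr/h_inj ->].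
have /choice [dec decP] : forall x, exists ke : K * bool, x = gmul L (h ke.1) (ue ke.2).
  by move=> x; have [k [e xE]] := cov x; exists (k, e).
have decE k e : dec (gmul L (h k) (ue e)) = (k, e).
  by have := decP (gmul L (h k) (ue e)); case: (dec _) => k' e' /dec_uniq.
have dec_mul k x : dec (gmul L (h k) x) = (gmul K k (dec x).1, (dec x).2).
  by rewrite {1}(decP x) gmul_assoc -hM decE.
(* The half-edge [(b, k, e)] starts at [h k] times [ue e]; [F] records the coset coordinates of its
   image under [f b]. *)
pose F (x : bool * K * bool) := dec (f x.1.1 (gmul L (h x.1.2) (ue x.2))).
have F_inj : injective F.
  move=> [[b k] e] [[b' k'] e'] eF; have /finj [-> /dec_uniq [-> ->] //] :
    f b (gmul L (h k) (ue e)) = f b' (gmul L (h k') (ue e')).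
  by rewrite (decP (f b _)) -/(F (b, k, e)) eF -decP.
(* Mates arrive at the same element of [K] through different cosets. *)
pose mate x y := (F x).1 = (F y).1 /\ (F x).2 = ~~ (F y).2.
have [||x y []|x []|x y z|c [csg cmate]] :=
    @two_coloring _ (fun x : bool * K * bool => (x.1, ~~ x.2)) mate.
- by case=> x b /=; rewrite negbK.
- by case=> x [] [].
- by rewrite /mate => -> ->; rewrite negbK.
- by move=> _; case: (F x).2.
- rewrite /mate => -[E1 E2] [E3 E4]; apply: F_inj.
  rewrite (surjective_pairing (F y)) -E1 E3 (surjective_pairing (F z)) /=.
  by congr (_, _); apply: negb_inj; rewrite -E2.
pose e b k := c (b, k, true).
have ce b k : c (b, k, e b k).
  by rewrite /e; case E: (c (b, k, true)) => //; have := csg (b, k, true); rewrite E.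
(* The first [m b] translations serve the half-edges starting in the subgroup, the next [m b] those
   starting in the coset of [u]. *)
exists (fun b i => if i < m b then (dec (s b i)).1 else (dec (gmul L u (s b (i - m b)))).1).
exists (fun b k => (F (b, k, e b k)).1); split=> [b k|b b' k k' eF].
  have [i [ltim fE]] := fs b (gmul L (h k) (ue (e b k))).
  rewrite /F /= fE -gmul_assoc dec_mul /=.
  case: (e b k) => /=; last by exists i; rewrite ltim gmul_one_l mul2n -addnn ltn_addr.
  by exists (m b + i); rewrite mul2n -addnn ltn_add2l ltim;
    rewrite ltnNge leq_addr /= addKn.
suff : (b, k, e b k) = (b', k', e b' k') by case.
apply: F_inj; rewrite (surjective_pairing (F _)) eF (surjective_pairing (F (b', _, _))) /=.
congr (_, _); apply/eqP; case: eqP => // ne.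
have := cmate (b, k, e b k) (b', k', e b' k'); rewrite !ce => H.
by have : true = false by apply: H; split=> //; case: (F _).2 ne; case: (F _).2.
Qed.

Import GRing.Theory.
Local Open Scope ring_scope.

(** * The Golod-Shafarevich inequality *)

Notation letter := 'I_16.
Notation word := (seq letter).
(* A list of words stands for its sum over F_2; repetitions cancel in pairs. *)
Notation poly := (seq word).

Definition pmul (p q : poly) : poly := [seq u ++ v | u <- p, v <- q].

Notation coeffs n := {ffun n.-tuple letter -> ('F_2)^o}.
(** Polynomials are compared degree by degree, in finite vector spaces where dimensions can be
    counted. *)
Definition homog n (p : poly) : coeffs n := [ffun t => (count_mem (tval t) p)%:R].

Section Homog.
Variable n : nat.

Lemma coeffs_addxx (x : coeffs n) : x + x = 0.
Proof.
apply/ffunP => t; rewrite !ffunE -mulr2n -mulr_natr.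
by rewrite (_ : 2%:R = 0) ?mulr0 //; apply: val_inj.
Qed.

Lemma homog_nil : homog n [::] = 0.
Proof. by apply/ffunP => t; rewrite !ffunE. Qed.

Lemma homog_cat p q : homog n (p ++ q) = homog n p + homog n q.
Proof. by apply/ffunP => t; rewrite !ffunE count_cat natrD. Qed.

Lemma homog_cons w p : homog n (w :: p) = homog n [:: w] + homog n p.
Proof. exact: (homog_cat [:: w]). Qed.

Lemma homog_flatten (T : Type) (F : T -> poly) s :
  homog n (flatten [seq F x | x <- s]) = \sum_(x <- s) homog n (F x).
Proof.
elim: s => [|x s IHs] /=; first by rewrite big_nil homog_nil.
by rewrite big_cons homog_cat IHs.
Qed.

Lemma homog_filter p : homog n p = homog n [seq w <- p | size w == n].
Proof.
apply/ffunP => t; rewrite !ffunE; congr _%:R; rewrite count_filter.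
by apply: eq_count => w /=; case: eqP => // ->; rewrite size_tuple eqxx.
Qed.

Lemma homog_neq p : all (fun w => size w != n) p -> homog n p = 0.
Proof.
move=> /allP pn; rewrite homog_filter (eq_in_filter (a2 := pred0)) ?filter_pred0 ?homog_nil //.
by move=> w /pn /negPf.
Qed.

Lemma homog_tuple (t : n.-tuple letter) : homog n [:: tval t] = [ffun t' => (t' == t)%:R].
Proof. by apply/ffunP => t'; rewrite !ffunE /= addn0 eq_sym. Qed.

Lemma homog_basis (f : coeffs n) : f = \sum_t f t *: homog n [:: tval t].
Proof.
apply/ffunP => t; rewrite sum_ffunE (bigD1 t) //= big1 ?addr0; last first.
  by move=> t' ne; rewrite homog_tuple !ffunE eq_sym (negPf ne) /GRing.scale /= mulr0.
by rewrite homog_tuple !ffunE eqxx /GRing.scale /= mulr1.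
Qed.

Lemma dim_coeffs : \dim (fullv : {vspace coeffs n}) = (16 ^ n)%N.
Proof. by rewrite dimvf /dim /= card_tuple card_ord muln1. Qed.

End Homog.

Lemma pmul_cons w p q : pmul (w :: p) q = pmul [:: w] q ++ pmul p q.
Proof. by rewrite {2}/pmul /= cats0. Qed.

Lemma pmul1l w p : pmul [:: w] p = [seq w ++ v | v <- p].
Proof. by rewrite /pmul /= cats0. Qed.

Lemma pmul_cat p q r : pmul (p ++ q) r = pmul p r ++ pmul q r.
Proof. by elim: p => // w p IHp; rewrite cat_cons pmul_cons IHp catA -pmul_cons. Qed.

Lemma pmulA p q r : pmul p (pmul q r) = pmul (pmul p q) r.
Proof.
elim: p => // w p IHp; rewrite pmul_cons [pmul (w :: p) q]pmul_cons pmul_cat -IHp.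
congr (_ ++ _); rewrite !pmul1l; elim: q {IHp} => // v q IHq.
rewrite pmul_cons map_cat IHq [RHS]pmul_cons; congr (_ ++ _).
by rewrite !pmul1l -map_comp; apply: eq_map => x /=; rewrite catA.
Qed.

Lemma homog_map n (T : Type) (F : T -> word) s :
  homog n [seq F x | x <- s] = \sum_(x <- s) homog n [:: F x].
Proof.
elim: s => [|x s IHs] /=; first by rewrite big_nil homog_nil.
by rewrite homog_cons big_cons IHs.
Qed.

Lemma homog_sum n p : homog n p = \sum_(w <- p) homog n [:: w].
Proof. by rewrite -[p in LHS]map_id homog_map. Qed.

Lemma homog_pmul n p q :
  homog n (pmul p q) = \sum_(u <- p) \sum_(v <- q) homog n [:: u ++ v].
Proof.
rewrite /pmul homog_flatten; apply: eq_bigr => u _; exact: homog_map.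
Qed.

Lemma homog_pmulC n p q :
  homog n (pmul p q) = \sum_(v <- q) homog n (pmul p [:: v]).
Proof.
rewrite homog_pmul exchange_big; apply: eq_bigr => v _.
by rewrite homog_pmul; apply: eq_bigr => u _; rewrite big_seq1.
Qed.

Section MulRight.
Variables (a n : nat) (r : poly).

(** Right multiplication by [r], extended linearly from words of length [a]; it agrees with [pmul]
    when [r] is homogeneous of degree [n - a]. *)
Definition mulr_fun (f : coeffs a) : coeffs n :=
  \sum_t f t *: homog n (pmul [:: tval t] r).

Lemma mulr_is_linear : linear mulr_fun.
Proof.
move=> k f g; rewrite /mulr_fun scaler_sumr -big_split /=; apply: eq_bigr => t _.
by rewrite !ffunE scalerDl scalerA.
Qed.
HB.instance Definition _ :=
  GRing.isLinear.Build 'F_2 (coeffs a) (coeffs n) _ mulr_fun mulr_is_linear.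

Definition mulr := linfun mulr_fun.

Lemma mulr_homog e p : all (fun w => size w == e) r -> (a + e)%N = n ->
  mulr (homog a p) = homog n (pmul p r).
Proof.
move=> /allP re aen; rewrite lfunE /= homog_sum.
elim: p => [|w p IHp]; first by rewrite big_nil linear0 homog_nil.
rewrite big_cons linearD /= IHp pmul_cons homog_cat; congr (_ + _).
have [/eqP wa|wa] := boolP (size w == a); last first.
  rewrite homog_neq /= ?wa // linear0 homog_neq //; apply/allP => v.
  rewrite pmul1l => /mapP [x /re /eqP xe ->]; rewrite size_cat xe -aen eqn_add2r.
  exact: wa.
have -> : w = tval (Tuple (introT eqP wa)) by [].
rewrite homog_tuple /= /mulr_fun (bigD1 (Tuple (introT eqP wa))) //= big1 ?addr0.
  by rewrite ffunE eqxx scale1r.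
by move=> t ne; rewrite ffunE (negPf ne) scale0r.
Qed.
End MulRight.

Section GolodShafarevich.
Variable rel : nat -> seq poly.
Hypothesis rel_homog : forall e r, r \in rel e -> all (fun w => size w == e) r.
Hypothesis rel0 : rel 0 = [::].
Hypothesis size_rel : forall e, (size (rel e) <= 4 ^ e)%N.

Definition ideal_gen n (x : coeffs n) := exists e r u v,
  r \in rel e /\ x = homog n (pmul (pmul [:: u] r) [:: v]).
(** The degree [n] part of the two-sided ideal generated by [rel]; [coeffs n] is a finite set, so
    its generators can be enumerated. *)
Definition ideal n : {vspace coeffs n} :=
  <<enum (fun x : coeffs n => `[< ideal_gen x >])>>%VS.

Lemma ideal_gen_mem n x : ideal_gen x -> x \in ideal n.
Proof. by move=> xg; apply: memv_span; rewrite mem_enum; apply/asboolP. Qed.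

Lemma ideal_sub n (U : {vspace coeffs n}) :
  (forall x, ideal_gen x -> x \in U) -> (ideal n <= U)%VS.
Proof. by move=> gU; apply/span_subvP => x; rewrite mem_enum => /asboolP /gU. Qed.

Let shift n : {vspace coeffs n.+1} :=
  (\sum_(i : letter) mulr n n.+1 [:: [:: i]] @: ideal n)%VS.

Lemma homog_shift n p w : w != [::] ->
  (forall u, homog n (pmul p [:: u]) \in ideal n) ->
  homog n.+1 (pmul p [:: w]) \in shift n.
Proof.
case/lastP: w => // w i _ pI; rewrite /shift (_ : pmul p _ = pmul (pmul p [:: w]) [:: [:: i]]).
  rewrite -(@mulr_homog n n.+1 _ 1) //; last by rewrite addn1.
  apply: (subvP (sumv_sup i _ (subvv _))) => //.
  exact: memv_img.
by rewrite -pmulA /pmul /= cats1.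
Qed.

(* Modulo the shift, a generator u r v with v nonempty vanishes, and in u r only
   the part of u in a complement of the ideal matters. *)
Lemma ideal_rec n : (ideal n.+1 <= shift n + \sum_(e < n.+2) \sum_(r <- rel e)
  mulr (n.+1 - e) n.+1 r @: (ideal (n.+1 - e))^C)%VS.
Proof.
apply: ideal_sub => _ [e [r [u [v [re ->]]]]].
have [v0|v0] := eqVneq v [::]; last first.
  apply: (subvP (addvSl _ _)); apply: homog_shift => // w.
  by apply: ideal_gen_mem; exists e, r, u, w.
rewrite {}v0; have -> : pmul (pmul [:: u] r) [:: [::]] = pmul [:: u] r.
  elim: (pmul _ r) => // w p IHp; rewrite pmul_cons IHp /pmul /= cats0 //.
have [ltne|lene] := ltnP n.+1 e.
  rewrite homog_neq ?mem0v //; apply/allP => w; rewrite pmul1l => /mapP [x /(allP (rel_homog re)) /eqP xe ->].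
  by rewrite size_cat xe; lia.
have ae : (n.+1 - e + e)%N = n.+1 by rewrite subnK.
rewrite -(mulr_homog _ (rel_homog re) ae).
have : homog (n.+1 - e) [:: u] \in (ideal (n.+1 - e) + (ideal (n.+1 - e))^C)%VS.
  by rewrite addv_complf memvf.
case/memv_addP => c cI [c' c'I ->]; rewrite linearD /=; apply: memv_add; last first.
  have lte : (e < n.+2)%N by rewrite ltnS.
  apply: (subvP (sumv_sup (Ordinal lte) _ (subvv _))) => //=.
  by rewrite (big_rem r) //=; apply: (subvP (addvSl _ _)); exact: memv_img.
(* The part of [u] inside the ideal is a sum of terms [u' r' v']; since [r] has positive degree,
   [v' r] consists of nonempty words, whose last letter can be split off. *)
suff /subvP : (mulr (n.+1 - e) n.+1 r @: ideal (n.+1 - e) <= shift n)%VS by apply; exact: memv_img.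
rewrite /ideal limg_span; apply/span_subvP => _ /mapP [x xI ->].
move: xI; rewrite mem_enum => /asboolP [e' [r' [u' [v' [re' ->]]]]].
rewrite (mulr_homog _ (rel_homog re) ae) homog_pmulC big_seq; apply: memv_suml => w wr.
rewrite -pmulA; have -> : pmul [:: v'] [:: w] = [:: v' ++ w] by [].
apply: homog_shift => [|z]; last by apply: ideal_gen_mem; exists e', r', u', z.
rewrite -size_eq0 size_cat (eqP (allP (rel_homog re) _ wr)).
by case: (e) re => [|e0]; rewrite ?rel0 // addnS.
Qed.

Let codim n : nat := \dim (ideal n)^C.

Lemma codimE n : (\dim (ideal n) + codim n = 16 ^ n)%N.
Proof. by rewrite /codim dimv_compl -dim_coeffs subnKC // dimvS // subvf. Qed.

Let dim_limg_leq m n (f : 'Hom(coeffs m, coeffs n)) U : (\dim (f @: U) <= \dim U)%N.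
Proof. by rewrite -(limg_ker_dim f U) leq_addl. Qed.

(** Counting dimensions in [ideal_rec] gives the Golod-Shafarevich inequality, where [codim n] is
    the dimension of the degree [n] part of the quotient algebra. *)
Lemma codim_rec n :
  (16 * codim n <= codim n.+1 + \sum_(e < n.+2) size (rel e) * codim (n.+1 - e))%N.
Proof.
have le1 : (\dim (shift n) <= 16 * \dim (ideal n))%N.
  apply: leq_trans (dimv_leq_sum _ _ _) _.
  apply: (@leq_trans (\sum_(i < 16) \dim (ideal n))); last by rewrite sum_nat_const card_ord.
  by apply: leq_sum => i _; exact: dim_limg_leq.
have le2 : (\dim (\sum_(e < n.+2) \sum_(r <- rel e)
    mulr (n.+1 - e) n.+1 r @: (ideal (n.+1 - e))^C)%VS <=
    \sum_(e < n.+2) size (rel e) * codim (n.+1 - e))%N.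
  apply: leq_trans (dimv_leq_sum _ _ _) _; apply: leq_sum => e _.
  apply: leq_trans (dimv_leq_sum _ _ _) _.
  apply: (@leq_trans (\sum_(r <- rel e) codim (n.+1 - e))); last first.
    by rewrite big_const_seq count_predT iter_addn_0 mulnC.
  by apply: leq_sum => r _; exact: dim_limg_leq.
have /leq_trans/(_ (leq_add le1 le2)) := leq_trans (dimvS (ideal_rec n)) (dimv_add_leqif _ _).
have := codimE n; have := codimE n.+1; rewrite expnS.
have aux (a b c d e f : nat) : (d + b = 16 * f -> c + a = f ->
    d <= 16 * c + e -> 16 * a <= b + e)%N by lia.
exact: aux.
Qed.

(** The identity 1/2 + ... + 1/2^m = 1 - 1/2^m with denominators cleared. *)
Lemma sum_geom_le (F : nat -> nat) (C m : nat) :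
    (forall e, (e < m)%N -> (2 ^ e.+1 * F e <= C)%N) ->
  (2 ^ m * \sum_(e < m) F e <= (2 ^ m - 1) * C)%N.
Proof.
elim: m => [|m IHm] leF; first by rewrite big_ord0 muln0.
rewrite big_ord_recr /= expnS.
have aux (c x S p : nat) : (2 * p * x <= c -> 0 < p -> p * S <= (p - 1) * c ->
    2 * p * (S + x) <= (2 * p - 1) * c)%N.
  move=> h1 h2 h3; have : (p * 2 * S <= 2 * (p - 1) * c)%N by nia.
  by nia.
apply: aux; rewrite ?expn_gt0 -?expnS //; first exact: leF.
by apply: IHm => e lt; apply: leF; exact: ltnW.
Qed.

(* Inductively codim (n - e) <= codim n / 8^e, so that the relators of degree
   e + 1 cost at most 4^(e+1) codim n / 8^e, and all of them together at most
   8 codim n out of 16 codim n. *)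
Lemma codim_grows n : (8 * codim n <= codim n.+1)%N.
Proof.
elim/ltn_ind: n => n IHn.
have pow e : (e <= n)%N -> (8 ^ e * codim (n - e) <= codim n)%N.
  elim: e => [|e IHe] len; first by rewrite mul1n subn0.
  apply: leq_trans (IHe (ltnW len)); rewrite expnSr -mulnA leq_pmul2l ?expn_gt0 //.
  by have := IHn (n - e.+1)%N; rewrite subnSK //; apply; lia.
have := codim_rec n; rewrite big_ord_recl rel0 mul0n add0n.
have le8 : (\sum_(i < n.+1) size (rel (bump 0 i)) * codim (n.+1 - bump 0 i) <= 8 * codim n)%N.
  have : (2 ^ n.+1 * \sum_(e < n.+1) size (rel e.+1) * codim (n.+1 - e.+1) <=
      (2 ^ n.+1 - 1) * (8 * codim n))%N.
    apply: sum_geom_le (fun e => size (rel e.+1) * codim (n.+1 - e.+1)) _ _ _ => e lte.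
    rewrite subSS; have := pow e lte; have := size_rel e.+1.
    have aux (r a b c d : nat) : (r <= 4 * a -> b * a * c <= d -> 2 * b * (r * c) <= 8 * d)%N.
      move=> h1 h2; have : (r * c <= 4 * a * c)%N by nia.
      by nia.
    (* Of the factor 8^e gained from [pow], 4^e pays for the number of relators and 2^e is left for
       the geometric sum. *)
    rewrite -[8%N]/(2 * 4)%N expnMn !expnS => h1 h2; exact: aux h1 h2.
  have aux (p x c : nat) : (0 < p -> p * x <= (p - 1) * c -> x <= c)%N by nia.
  by move/aux; apply; rewrite expn_gt0.
have aux (a b c : nat) : (c <= 8 * a -> 16 * a <= b + c -> 8 * a <= b)%N by lia.
exact: aux.
Qed.

Lemma ideal_proper n : exists u, size u = n /\ homog n [:: u] \notin ideal n.
Proof.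
have codim_gt0 : (0 < codim n)%N.
  elim: n => [|n IHn]; last by have := codim_grows n; lia.
  (* All relators have positive degree, so the ideal has no part in degree 0. *)
  have : (ideal 0 <= 0)%VS.
    apply: ideal_sub => _ [e [r [u [v [re ->]]]]].
    case: e re => [|e re]; first by rewrite rel0.
    rewrite homog_neq ?mem0v //; apply/allP => w /allpairsP [[x y] /= [xr _ ->]].
    move: xr; rewrite pmul1l => /mapP [z /(allP (rel_homog re)) /eqP sz ->].
    by rewrite !size_cat sz; lia.
  by rewrite subv0 => /eqP I0; have := codimE 0; rewrite I0 dimv0; lia.
have [//|none] := pselect (exists u, size u = n /\ homog n [:: u] \notin ideal n).
suff /dimvS : (fullv <= ideal n)%VS by rewrite dim_coeffs; have := codimE n; lia.
apply/subvP => f _; rewrite (homog_basis f); apply: memv_suml => t _; apply: memvZ.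
by apply: contrapT => /negP nI; apply: none; exists t; rewrite size_tuple.
Qed.
End GolodShafarevich.

(** * A nil quotient without left annihilators *)

Local Open Scope quotient_scope.

Section Action.
Variables (W : zmodType) (X : letter -> W -> W).
Definition word_act (w : word) (x : W) : W := foldr X x w.
Definition poly_act (p : poly) (x : W) : W := \sum_(w <- p) word_act w x.
End Action.

(* A left module over the free algebra on which it acts through a nil algebra;
   em_deg is 1 + the degree, and 0 on the zero vector. *)
Record expanding_module := ExpandingModule {
  em_space :> zmodType;
  em_act : letter -> em_space -> em_space;
  em_deg : em_space -> nat;
  em_addxx : forall x : em_space, x + x = 0;
  em_actD : forall i x y, em_act i (x + y) = em_act i x + em_act i y;
  em_nontrivial : exists x : em_space, x <> 0;
  em_deg0 : em_deg 0 = 0%N;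
  em_deg_eq0 : forall x, em_deg x = 0%N -> x = 0;
  em_degD : forall x y, (em_deg (x + y)%R <= maxn (em_deg x) (em_deg y))%N;
  em_deg_act : forall x, x <> 0 -> exists i, em_deg (em_act i x) = (em_deg x).+1;
  em_nil : forall j (fs : seq poly), (0 < j)%N -> (size fs <= 4 ^ j)%N ->
    all (all (fun w => (j <= size w)%N)) fs ->
    exists N, forall gs, size gs = N -> {subset gs <= fs} ->
      forall x, foldr (poly_act em_act) x gs = 0
}.

Definition pprod (gs : seq poly) : poly := foldr pmul [:: [::]] gs.

Lemma pmul_allP (P Q R : pred word) p q : (forall u v, P u -> Q v -> R (u ++ v)) ->
  all P p -> all Q q -> all R (pmul p q).
Proof.
move=> PQR /allP Pp /allP Qq; apply/allP => _ /allpairsP [[u v] /= [/Pp Pu /Qq Qv ->]].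
exact: PQR.
Qed.

Lemma all_pmul1 u (Q R : pred word) p : (forall v, Q v -> R (u ++ v)) ->
  all Q p -> all R (pmul [:: u] p).
Proof. by move=> QR Qp; apply: (@pmul_allP (pred1 u) Q) => //= [_ v /eqP ->|]; rewrite ?eqxx //; exact: QR. Qed.

Section Quotient.
Variable rel : nat -> seq poly.
Hypothesis rel_homog : forall e r, r \in rel e -> all (fun w => size w == e) r.
Hypothesis rel0 : rel 0 = [::].
Hypothesis size_rel : forall e, (size (rel e) <= 4 ^ e)%N.

(* The elements p with R_+^n p = 0 in R = F_2<X>/(rel) for some n; dividing by
   them leaves no element annihilated by all letters on the left. *)
Definition negligible (p : poly) : Prop := exists n0, forall u : word,
  (n0 <= size u)%N -> forall n, homog n (pmul [:: u] p) \in ideal rel n.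

Lemma negligible_lin p q r :
    (forall n u, homog n (pmul [:: u] r) = homog n (pmul [:: u] p) + homog n (pmul [:: u] q)) ->
  negligible p -> negligible q -> negligible r.
Proof.
move=> E [n1 n1P] [n2 n2P]; exists (maxn n1 n2) => u; rewrite geq_max => /andP [u1 u2] n.
by rewrite E memvD ?n1P ?n2P.
Qed.

Lemma homog_pmul1_cat n u p q :
  homog n (pmul [:: u] (p ++ q)) = homog n (pmul [:: u] p) + homog n (pmul [:: u] q).
Proof. by rewrite !pmul1l map_cat homog_cat. Qed.

(** In characteristic 2 the concatenation [p ++ q] represents the difference of [p] and [q]. *)
Definition congr_mod (p q : poly) : bool := `[< negligible (p ++ q) >].

Lemma congr_mod_refl : reflexive congr_mod.
Proof.
move=> p; apply/asboolP; exists 0%N => u _ n.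
by rewrite homog_pmul1_cat coeffs_addxx mem0v.
Qed.

Lemma congr_mod_sym : symmetric congr_mod.
Proof.
suff imp p q : negligible (p ++ q) -> negligible (q ++ p).
  by move=> p q; apply: asbool_equiv_eq; split; exact: imp.
by move=> [n0 n0P]; exists n0 => u /n0P uP n; rewrite homog_pmul1_cat addrC -homog_pmul1_cat.
Qed.

Lemma congr_mod_trans : transitive congr_mod.
Proof.
move=> q p r /asboolP pq /asboolP qr; apply/asboolP.
apply: negligible_lin pq qr => n u; rewrite !homog_pmul1_cat -[RHS]addrA.
by rewrite [X in _ = _ + X]addrA coeffs_addxx add0r.
Qed.

Canonical congr_mod_equiv := EquivRel congr_mod congr_mod_refl congr_mod_sym congr_mod_trans.
Definition quot := {eq_quot congr_mod}.
HB.instance Definition _ := Choice.on quot.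
HB.instance Definition _ := EqQuotient.on quot.

Lemma pi_eqP (p q : poly) : (\pi_quot p = \pi_quot q) <-> negligible (p ++ q).
Proof.
split=> [E|pq].
  by apply/asboolP; exact: (introT (@eqmodP _ congr_mod_equiv p q) E).
exact/(@eqmodP _ congr_mod_equiv p q)/asboolP.
Qed.

Definition quot_add (x y : quot) : quot := \pi_quot (repr x ++ repr y).

Lemma quot_addE p q : quot_add (\pi_quot p) (\pi_quot q) = \pi_quot (p ++ q).
Proof.
have /pi_eqP pp : \pi_quot (repr (\pi_quot p)) = \pi_quot p by rewrite reprK.
have /pi_eqP qq : \pi_quot (repr (\pi_quot q)) = \pi_quot q by rewrite reprK.
apply/pi_eqP; apply: negligible_lin pp qq => n u; rewrite !homog_pmul1_cat.
by rewrite addrACA.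
Qed.

Lemma quot_addA : associative quot_add.
Proof.
move=> x y z; rewrite -[x]reprK -[y]reprK -[z]reprK.
move: (repr x) (repr y) (repr z) => p q r.
by rewrite (quot_addE q r) (quot_addE p q) !quot_addE catA.
Qed.
Lemma quot_addC : commutative quot_add.
Proof.
move=> x y; rewrite -[x]reprK -[y]reprK !quot_addE; apply/pi_eqP.
exists 0%N => u _ n; rewrite !homog_pmul1_cat [X in _ + X]addrC coeffs_addxx; exact: mem0v.
Qed.
Lemma quot_add0 : left_id (\pi_quot [::]) quot_add.
Proof. by move=> x; rewrite -[x]reprK quot_addE. Qed.
Lemma quot_addN : left_inverse (\pi_quot [::]) id quot_add.
Proof.
move=> x; rewrite -[x]reprK quot_addE; apply/pi_eqP; rewrite cats0.
exact/asboolP/congr_mod_refl.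
Qed.
HB.instance Definition _ :=
  GRing.isZmodule.Build quot quot_addA quot_addC quot_add0 quot_addN.

Lemma quot_addxx (x : quot) : x + x = 0.
Proof. exact: quot_addN. Qed.

Lemma pi_cat p q : \pi_quot (p ++ q) = \pi_quot p + \pi_quot q.
Proof. exact/esym/quot_addE. Qed.

Definition letter_act (i : letter) (x : quot) : quot := \pi_quot (pmul [:: [:: i]] (repr x)).

(** Well defined because appending [i] to a long word [u] gives a word that is still long enough to
    annihilate a negligible element. *)
Lemma letter_actE i p : letter_act i (\pi_quot p) = \pi_quot (pmul [:: [:: i]] p).
Proof.
have /pi_eqP [n0 n0P] : \pi_quot (repr (\pi_quot p)) = \pi_quot p by rewrite reprK.
apply/pi_eqP; exists n0 => u lu n; have := n0P (rcons u i) _ n.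
rewrite size_rcons; move/(_ (leqW lu)).
rewrite homog_pmul1_cat (homog_pmul1_cat n u (pmul _ _) (pmul _ _)) !pmulA.
by have -> : pmul [:: u] [:: [:: i]] = [:: rcons u i] by rewrite /pmul /= cats1.
Qed.

Lemma letter_actD i x y : letter_act i (x + y) = letter_act i x + letter_act i y.
Proof.
by rewrite -[x]reprK -[y]reprK -pi_cat !letter_actE -pi_cat !pmul1l map_cat.
Qed.

Lemma word_actE w p : word_act letter_act w (\pi_quot p) = \pi_quot (pmul [:: w] p).
Proof.
elim: w => [|i w IHw] /=; first by rewrite pmul1l map_id.
by rewrite IHw letter_actE pmulA.
Qed.

Lemma poly_actE p q : poly_act letter_act p (\pi_quot q) = \pi_quot (pmul p q).
Proof.
elim: p => [|w p IHp]; first by rewrite /poly_act big_nil.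
by rewrite /poly_act big_cons -/(poly_act _ _ _) IHp word_actE -pi_cat -pmul_cons.
Qed.

(** The class of the unit is nonzero, since words of every length survive outside the ideal. *)
Lemma quot_nontrivial : exists x : quot, x <> 0.
Proof.
exists (\pi_quot [:: [::]]) => /pi_eqP [n0 n0P].
have [u [su]] := ideal_proper rel_homog rel0 size_rel n0.
by have := n0P u _ n0; rewrite su => /(_ (leqnn _)); rewrite /pmul /= cats0 => ->.
Qed.

Definition deg_lt n (x : quot) : bool :=
  `[< exists p, \pi_quot p = x /\ all (fun w => size w < n)%N p >].

Lemma deg_ltW m n x : (m <= n)%N -> deg_lt m x -> deg_lt n x.
Proof.
move=> mn /asboolP [p [px pm]]; apply/asboolP; exists p; split=> //.
by apply: sub_all pm => w /leq_trans; apply.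
Qed.

Lemma deg_lt_ex x : exists n, deg_lt n x.
Proof.
exists (\max_(w <- repr x) size w).+1; apply/asboolP; exists (repr x).
split; first exact: reprK.
apply/allP => w wx; rewrite ltnS; exact: leq_bigmax_seq.
Qed.

Definition deg x := ex_minn (deg_lt_ex x).

Lemma deg_leP n x : (deg x <= n)%N <-> deg_lt n x.
Proof.
rewrite /deg; case: ex_minnP => m mP min; split=> [mn|]; last exact: min.
exact: deg_ltW mP.
Qed.

Lemma deg0 : deg 0 = 0%N.
Proof. by apply/eqP; rewrite -leqn0; apply/deg_leP/asboolP; exists [::]. Qed.

Lemma deg_eq0 x : deg x = 0%N -> x = 0.
Proof.
move=> x0; have /deg_leP/asboolP [[|w p] [<- //]] : (deg x <= 0)%N by rewrite x0.
Qed.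

Lemma degD x y : (deg (x + y)%R <= maxn (deg x) (deg y))%N.
Proof.
have /deg_leP/asboolP [p [px pm]] := leq_maxl (deg x) (deg y).
have /deg_leP/asboolP [q [qy qm]] := leq_maxr (deg x) (deg y).
by apply/deg_leP/asboolP; exists (p ++ q); rewrite pi_cat px qy all_cat pm qm.
Qed.

Lemma homog_split n (u : word) (P : pred word) (p : poly) :
  homog n (pmul [:: u] p) =
  homog n (pmul [:: u] (filter P p)) + homog n (pmul [:: u] (filter (predC P) p)).
Proof.
rewrite !pmul1l !homog_map !big_filter (bigID P) /=.
by [].
Qed.

(** There are finitely many letters, so the bounds for the individual letters have a maximum. *)
Lemma negligible_letters p :
  (forall i, negligible (pmul [:: [:: i]] p)) -> negligible p.
Proof.
move=> /choice [f fP]; exists (\max_i f i).+1 => u lu n.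
case/lastP: u lu => // u i; rewrite size_rcons ltnS => lu.
have := fP i u (leq_trans (leq_bigmax i) lu) n; rewrite pmulA.
by have -> : pmul [:: u] [:: [:: i]] = [:: rcons u i] by rewrite /pmul /= cats1.
Qed.

(** If no letter raised the degree, every letter would send the top component of a shortest
    representative to a negligible element; that component would itself be negligible and could be
    dropped. *)
Lemma deg_letter_act x : x <> 0 -> exists i, deg (letter_act i x) = (deg x).+1.
Proof.
move=> x0; have /deg_leP/asboolP [p [px pm]] := leqnn (deg x).
have deg_gt0 : (0 < deg x)%N by rewrite lt0n; apply/eqP => /deg_eq0.
have degS i : (deg (letter_act i x) <= (deg x).+1)%N.
  apply/deg_leP/asboolP; exists (pmul [:: [:: i]] p); split; first by rewrite -px letter_actE.
  by apply: all_pmul1 pm => v lv; rewrite /= ltnS.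
apply: contrapT => none.
pose top w := (size (w : word)).+1 == deg x.
have neg_top : negligible (filter top p).
  apply: negligible_letters => i.
  have /deg_leP/asboolP [q [qx qm]] : (deg (letter_act i x) <= deg x)%N.
    by rewrite -ltnS ltn_neqAle degS andbT; apply/eqP => E; apply: none; exists i.
  have /pi_eqP [n0 n0P] : \pi_quot (pmul [:: [:: i]] p) = \pi_quot q.
    by rewrite qx -px letter_actE.
  exists n0 => u lu n.
  (* Top words have length [deg x] minus 1, so after [u] and [i] they live exactly in this degree,
     which the lower words of [p] and all words of [q] miss. *)
  have [nE|nE] := eqVneq n (size u + deg x)%N; last first.
    rewrite homog_neq ?mem0v // pmulA; have -> : pmul [:: u] [:: [:: i]] = [:: rcons u i] by rewrite /pmul /= cats1.
    apply: all_pmul1 (filter_all top p) => b /eqP tb.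
    by rewrite size_cat size_rcons addSnnS tb eq_sym.
  have := n0P u lu n; rewrite homog_pmul1_cat [X in _ + X]homog_neq ?addr0; last first.
    apply: all_pmul1 qm => b sb.
    by rewrite size_cat nE eqn_add2l ltn_eqF.
  rewrite pmulA; have -> : pmul [:: u] [:: [:: i]] = [:: rcons u i] by rewrite /pmul /= cats1.
  rewrite (homog_split _ _ top) [X in _ + X]homog_neq ?addr0; last first.
    apply: all_pmul1 (filter_all (predC top) p) => b tb.
    by rewrite size_cat size_rcons addSnnS nE eqn_add2l.
  by rewrite pmulA; have -> : pmul [:: u] [:: [:: i]] = [:: rcons u i] by rewrite /pmul /= cats1.
have : (deg x <= (deg x).-1)%N; last by rewrite -ltnS prednK // ltnn.
apply/deg_leP/asboolP; exists (filter (predC top) p); split.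
  rewrite -px; apply/pi_eqP; have [n0 n0P] := neg_top; exists n0 => u lu n.
  by rewrite homog_pmul1_cat [X in _ + X](homog_split _ _ top) addrCA coeffs_addxx addr0 n0P.
apply/allP => w; rewrite mem_filter => /andP [/= tw /(allP pm) lw].
by rewrite -ltnS prednK // ltn_neqAle tw.
Qed.

Hypothesis rel_nil : forall j (fs : seq poly), (0 < j)%N -> (size fs <= 4 ^ j)%N ->
    all (all (fun w => (j <= size w)%N)) fs ->
    exists N, forall gs, size gs = N -> {subset gs <= fs} ->
      forall n u v, homog n (pmul (pmul [:: u] (pprod gs)) [:: v]) \in ideal rel n.

Lemma quot_nil j (fs : seq poly) : (0 < j)%N -> (size fs <= 4 ^ j)%N ->
    all (all (fun w => (j <= size w)%N)) fs ->
    exists N, forall gs, size gs = N -> {subset gs <= fs} ->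
      forall x, foldr (poly_act letter_act) x gs = 0.
Proof.
move=> j0 fsj fsP; have [N NP] := rel_nil j0 fsj fsP; exists N => gs sgs gsfs x.
have -> : foldr (poly_act letter_act) x gs = \pi_quot (pmul (pprod gs) (repr x)).
  elim: gs {sgs gsfs} => [|g gs IHgs] /=; first by rewrite pmul1l map_id reprK.
  by rewrite IHgs poly_actE pmulA.
apply/pi_eqP; rewrite cats0; exists 0%N => u _ n.
rewrite pmulA homog_pmulC; apply: memv_suml => v _; exact: NP.
Qed.

Definition quot_module : expanding_module :=
  ExpandingModule quot_addxx letter_actD quot_nontrivial deg0 deg_eq0 degD deg_letter_act quot_nil.
End Quotient.

(** * Golod's relators for all finite tuples *)

Section Relators.
Local Open Scope nat_scope.

Fixpoint lists (T : Type) (s : seq T) n : seq (seq T) :=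
  if n is n'.+1 then [seq x :: l | x <- s, l <- lists s n'] else [:: [::]].

Lemma size_lists (T : Type) (s : seq T) n : size (lists s n) = size s ^ n.
Proof. by elim: n => //= n IHn; rewrite size_allpairs IHn expnS. Qed.

Lemma mem_lists (T : eqType) (s l : seq T) : {subset l <= s} -> l \in lists s (size l).
Proof.
elim: l => [|x l IHl] //= ls; apply: allpairs_f; first by apply: ls; rewrite mem_head.
by apply: IHl => y yl; apply: ls; rewrite inE yl orbT.
Qed.

Lemma pprod_size_ge j (gs : seq poly) : all (all (fun w => j <= size w)) gs ->
  all (fun w => j * size gs <= size w) (pprod gs).
Proof.
elim: gs => [|g gs IHgs] /=; first by rewrite muln0.
move=> /andP [gj /IHgs]; apply: pmul_allP gj => u v uj vj.
by rewrite size_cat mulnS leq_add.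
Qed.

Lemma pprod_size_le j (gs : seq poly) : all (all (fun w => size w <= j)) gs ->
  all (fun w => size w <= j * size gs) (pprod gs).
Proof.
elim: gs => [|g gs IHgs] //= /andP [gj /IHgs]; apply: pmul_allP gj => u v uj vj.
by rewrite size_cat mulnS leq_add.
Qed.

(** Pairs [(j, fs)] form a countable type; numbers that are no code default to [j = 0], which
    [admissible] rejects. *)
Definition tuple_nb s : nat * seq poly := odflt (0, [::]) (unpickle s).
Definition max_len s := maxn 1 (\max_(f <- (tuple_nb s).2) \max_(w <- f) size w).

(* The N-fold products of the s-th tuple, with N = start s, only have words of
   length in [start s, start s.+1[, so that distinct tuples contribute relators
   of distinct degrees. *)
Fixpoint start s := if s is s'.+1 then (max_len s' * start s').+1 else 1.

Lemma start_lt s : start s < start s.+1.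
Proof. by rewrite /= ltnS leq_pmull // leq_maxl. Qed.

Lemma start_mono s t : s <= t -> start s <= start t.
Proof.
move=> /subnKC <-; elim: (t - s) => [|n IHn]; first by rewrite addn0.
by rewrite addnS (leq_trans IHn) // ltnW // start_lt.
Qed.

Lemma start_gt s : s < start s.
Proof. by elim: s => // s IHs; apply: leq_ltn_trans IHs (start_lt s). Qed.

Lemma slot_ex e : exists s, e < start s.+1.
Proof. by exists e; apply: ltn_trans (start_gt e) (start_lt e). Qed.
Definition slot e := ex_minn (slot_ex e).

Lemma slotE s e : start s <= e < start s.+1 -> slot e = s.
Proof.
move=> /andP [se es]; rewrite /slot; case: ex_minnP => t et min.
apply/eqP; rewrite eqn_leq min // leqNgt; apply/negP => ts.
by have := leq_trans et (start_mono ts); rewrite ltnNge se.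
Qed.

Definition admissible s := let: (j, fs) := tuple_nb s in
  [&& 0 < j, size fs <= 4 ^ j & all (all (fun w => j <= size w)) fs].

(** The bound [(tuple_nb s).1 * start s <= e] discards only zero components, and it yields the count
    (4^j)^N <= 4^e of N-fold products. *)
Definition relators e : seq poly :=
  let s := slot e in
  if [&& 0 < e, admissible s & (tuple_nb s).1 * start s <= e] then
    [seq [seq w <- pprod gs | size w == e] | gs <- lists (tuple_nb s).2 (start s)]
  else [::].

Lemma relators_homog e r : r \in relators e -> all (fun w => size w == e) r.
Proof. by rewrite /relators; case: ifP => // _ /mapP [gs _ ->]; exact: filter_all. Qed.

Lemma relators0 : relators 0 = [::].
Proof. by []. Qed.

Lemma size_relators e : size (relators e) <= 4 ^ e.
Proof.
rewrite /relators; case: ifP => // /and3P [_]; rewrite /admissible.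
case: (tuple_nb _) => j fs /and3P [_ fsj _] /= je.
have start_gt0 : 0 < start (slot e) by exact: leq_ltn_trans (start_gt _).
rewrite size_map size_lists (@leq_trans ((4 ^ j) ^ start (slot e))) ?leq_exp2r //.
by rewrite -expnM leq_exp2l.
Qed.

Lemma pmul_sandwich u p v : pmul (pmul [:: u] p) [:: v] = [seq u ++ w ++ v | w <- p].
Proof.
by rewrite pmul1l; elim: p => // w p IHp; rewrite map_cons pmul_cons IHp /= catA.
Qed.

(** [N] is the [start] of the code of [(j, fs)]: every homogeneous component of an N-fold product is
    then a relator or zero. *)
Lemma relators_nil j (fs : seq poly) : 0 < j -> size fs <= 4 ^ j ->
    all (all (fun w => j <= size w)) fs ->
    exists N, forall gs, size gs = N -> {subset gs <= fs} ->
      forall n u v, homog n (pmul (pmul [:: u] (pprod gs)) [:: v]) \in ideal relators n.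
Proof.
move=> j0 fsj fsP; pose s := pickle (j, fs).
have sE : tuple_nb s = (j, fs) by rewrite /tuple_nb pickleK.
exists (start s) => gs gsN gsfs n u v.
have /pprod_size_ge/allP ge : all (all (fun w => j <= size w)) gs.
  by apply/allP => g /gsfs; exact/allP.
have /pprod_size_le/allP le : all (all (fun w => size w <= max_len s)) gs.
  apply/allP => g /gsfs gfs; apply/allP => w wg; rewrite /max_len sE leq_max; apply/orP; right.
  apply: leq_trans (leq_bigmax_seq _ gfs isT) => /=.
  exact: leq_bigmax_seq.
rewrite gsN in ge le.
have [lt|le_n] := ltnP n (size u + size v).
  rewrite homog_neq ?mem0v // pmul_sandwich; apply/allP => _ /mapP [w _ ->].
  by rewrite !size_cat; lia.
(* Only the component of degree [e] of the product reaches degree [n] between [u] and [v]. *)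
pose e := n - (size u + size v); pose r := [seq w <- pprod gs | size w == e].
have -> : homog n (pmul (pmul [:: u] (pprod gs)) [:: v]) = homog n (pmul (pmul [:: u] r) [:: v]).
  rewrite !pmul_sandwich !homog_map big_filter [LHS](bigID (fun w => size w == e)) /=.
  rewrite [X in (_ + X)%R]big1 ?addr0 // => w we; apply: homog_neq.
  by rewrite /= !size_cat andbT; apply: contra we => /eqP nE; apply/eqP; rewrite /e; lia.
have [/hasP [w wP /eqP we]|] := boolP (has (fun w => size w == e) (pprod gs)); last first.
  by rewrite has_filter negbK -/r => /eqP ->; rewrite pmul_sandwich homog_nil mem0v.
have es : slot e = s.
  apply: slotE; rewrite /= ltnS -we le // andbT (leq_trans _ (ge _ wP)) //.
  by rewrite leq_pmull.
apply: ideal_gen_mem; exists e, r, u, v; split=> //.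
rewrite /relators es /admissible sE j0 fsj fsP /= -we ge // andbT.
have -> : 0 < size w.
  by apply: leq_trans (ge _ wP); rewrite muln_gt0 j0 (leq_ltn_trans _ (start_gt s)).
by rewrite /= we -gsN; apply: map_f; exact: mem_lists.
Qed.

Definition golod_module : expanding_module :=
  quot_module relators_homog relators0 size_relators relators_nil.
End Relators.

(** * Interpolation along index-two subgroups *)

Section FunctionGroup.
Variables (V : Type) (P : (V -> V) -> Prop).

Record is_group : Prop := IsGroup {
  isg_id : P id;
  isg_comp : forall g h, P g -> P h -> P (g \o h);
  isg_inv : forall g, P g -> exists h, [/\ P h, cancel g h & cancel h g]
}.
Hypothesis PG : is_group.

Let T := {g : V -> V | P g}.
Let T_eq (x y : T) : sval x = sval y -> x = y.
Proof. by case: x y => [g Pg] [h Ph] /= E; subst h; congr exist; exact: Prop_irrelevance. Qed.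
Let mulT (x y : T) : T := exist _ _ (isg_comp PG (svalP x) (svalP y)).
Let oneT : T := exist _ _ (isg_id PG).
Let invT (x : T) : T :=
  let h := cid (isg_inv PG (svalP x)) in
  exist _ (projT1 h) (let: And3 Ph _ _ := projT2 h in Ph).

Let mulA x y z : mulT x (mulT y z) = mulT (mulT x y) z. Proof. exact: T_eq. Qed.
Let mul1 x : mulT oneT x = x. Proof. exact: T_eq. Qed.
Let mulr1 x : mulT x oneT = x. Proof. exact: T_eq. Qed.
Let mulV x : mulT (invT x) x = oneT.
Proof.
apply: T_eq => /=; apply/funext => v /=.
by case: (cid _) => h [_ gK hK] /=; rewrite gK.
Qed.
Let mulrV x : mulT x (invT x) = oneT.
Proof.
apply: T_eq => /=; apply/funext => v /=.
by case: (cid _) => h [_ gK hK] /=; rewrite hK.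
Qed.

Definition fgroup : Defs.Group := @Build_Group T mulT oneT invT mulA mul1 mulr1 mulV mulrV.

Lemma fgroup_eq (x y : fgroup) : sval x =1 sval y -> x = y.
Proof. by move=> E; apply: T_eq; exact/funext. Qed.

Lemma fgroupKV (x : fgroup) : cancel (sval (ginv fgroup x)) (sval x).
Proof. by move=> v; have := gmul_inv_r fgroup x => /(congr1 (fun y : fgroup => sval y v)). Qed.
End FunctionGroup.

Section Extension.
Variable V : Type.
Implicit Types (P Q : (V -> V) -> Prop) (u : V -> V).

(** The union of [P] and its coset by [u]: a group containing [P] with index at most two when [u]
    normalizes [P] and has its square in [P]. *)
Definition ext P u (g : V -> V) : Prop := exists k, P k /\ (g = k \/ g = k \o u).

Lemma ext_sub P u g : P g -> ext P u g.
Proof. by exists g; split=> //; left. Qed.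

Lemma ext_self P u : P id -> ext P u u.
Proof. by exists id; split=> //; right. Qed.

Lemma ext_id P u : is_group P -> P u -> ext P u = P.
Proof.
move=> PG Pu; apply/funext => g; apply/propext; split=> [[k [Pk [->|->]]]|] //.
  exact: isg_comp.
exact: ext_sub.
Qed.

(** Normality moves [u] to the right, as in [k u l = k (u l u') u]; two copies of [u] or of [u'] are
    absorbed by [P]. *)
Lemma ext_group P u u' : is_group P -> cancel u u' -> cancel u' u ->
  P (u \o u) -> P (u' \o u') ->
  (forall k, P k -> P (u \o k \o u') /\ P (u' \o k \o u)) -> is_group (ext P u).
Proof.
move=> PG uK u'K Puu Pu'u' norm; split; first by apply: ext_sub; exact: isg_id PG.
- move=> _ _ [k [Pk [->|->]]] [l [Pl [->|->]]].
  + by apply: ext_sub; exact: isg_comp.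
  + by exists (k \o l); split; [exact: isg_comp|right].
  + exists (k \o (u \o l \o u')); split; first by apply: isg_comp => //; case: (norm l Pl).
    by right; apply/funext => v /=; rewrite uK.
  + exists (k \o (u \o l \o u') \o (u \o u)); split.
      by apply: isg_comp => //; apply: isg_comp => //; case: (norm l Pl).
    by left; apply/funext => v /=; rewrite uK.
- move=> g [k [Pk kE]]; have [h [Ph kK hK]] := isg_inv PG Pk.
  case: kE => ->; first by exists h; split=> //; exact: ext_sub.
  exists (u' \o h); split=> [|v|v] /=; last 2 first.
  + by rewrite kK uK.
  + by rewrite u'K hK.
  exists ((u' \o h \o u) \o (u' \o u')); split.
    by apply: isg_comp => //; case: (norm h Ph).
  by right; apply/funext => v /=; rewrite uK u'K.
Qed.

Lemma paradox_ext P u (PG : is_group P) (QG : is_group (ext P u)) m : ~ P u ->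
  paradox (fgroup QG) m -> paradox (fgroup PG) (fun b => 2 * m b)%N.
Proof.
move=> nPu; pose iota (x : fgroup PG) : fgroup QG :=
  exist _ (sval x) (ext_sub u (svalP x)).
pose uQ : fgroup QG := exist _ u (ext_self u (isg_id PG)).
apply: (@paradox_index2 _ _ iota uQ).
- by move=> x y; apply: fgroup_eq.
- by move=> x y /(congr1 sval) /= E; apply: fgroup_eq => v; rewrite E.
- by move=> x /(congr1 sval) /= E; apply: nPu; rewrite -E; exact: svalP.
- move=> x; have [k [Pk kE]] := svalP x; exists (exist _ k Pk).
  by case: kE => kE; [exists false|exists true]; apply: fgroup_eq => v; rewrite kE.
Qed.
End Extension.

Section Interpolation.
Variables (V : Type) (n : nat).
Implicit Types (P : (V -> V) -> Prop).

Definition small P := exists (PG : is_group P) m, paradox (fgroup PG) m /\ (m true + m false < n)%N.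
Definition in_range := exists H : Defs.Group, non_amenable H /\
  exists t, is_tarski_number H t /\ (n <= t)%coq_nat /\ (t <= 2 * n)%coq_nat.

(* Index two at most doubles the Tarski number, so it cannot jump from below n
   to above 2 n. *)
Lemma small_ext P u : is_group P -> is_group (ext P u) ->
  small (ext P u) -> small P \/ in_range.
Proof.
move=> PG QG [QG' [m [Qm mn]]].
have [Pu|nPu] := pselect (P u).
  by left; move: QG' Qm; rewrite (ext_id PG Pu) => QG' Qm; exists QG', m.
have Pm := @paradox_ext _ _ _ PG _ _ nPu Qm; set m' := (fun b => _) in Pm.
pose size_of t := `[< exists m, paradox (fgroup PG) m /\ (m true + m false)%N = t >].
have ex_t : exists t, size_of t by exists (m' true + m' false)%N; apply/asboolP; exists m'.
case: (ex_minnP ex_t) => t /asboolP [mt [Pmt mtE]] min_t.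
have [tn|nt] := ltnP t n; first by left; exists PG, mt; rewrite mtE.
right; exists (fgroup PG); split; first exact: paradox_non_amenable Pmt.
exists t; split; last first.
  split; apply/leP => //; apply: leq_trans (min_t _ _) _; first by apply/asboolP; exists m'.
  by rewrite /m'; lia.
split; first by exists (mt true), (mt false); split=> //; exact: decomposition_of_paradox.
move=> a b /paradox_of_decomposition Pab; apply/leP/min_t/asboolP.
by exists (fun c => if c then a else b).
Qed.
End Interpolation.

(** * Congruence subgroups of 2 x 2 matrices over the nil algebra *)

Section MatrixGroups.
Variable M : expanding_module.
Notation W := (em_space M).
Notation V := (W * W)%type.
Notation wact := (word_act (@em_act M)).
Notation pact := (poly_act (@em_act M)).
Implicit Types (S T : V -> V) (v : V).

Definition is_additive T := forall x y, T (x + y) = T x + T y.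

Lemma addxxV v : v + v = 0.
Proof. by case: v => x y; rewrite [LHS](_ : _ = (x + x, y + y)) // !em_addxx. Qed.

Lemma em_act0 i : em_act i (0 : W) = 0.
Proof. by apply: (addrI (em_act i 0)); rewrite -em_actD !addr0. Qed.

Lemma wactD w x y : wact w (x + y) = wact w x + wact w y.
Proof. by elim: w => //= i w ->; rewrite em_actD. Qed.

Lemma wact0 w : wact w 0 = 0.
Proof. by elim: w => //= i w ->; rewrite em_act0. Qed.

Lemma wact_cat u w x : wact (u ++ w) x = wact u (wact w x).
Proof. by rewrite /word_act foldr_cat. Qed.

Lemma pactD p x y : pact p (x + y) = pact p x + pact p y.
Proof. by rewrite /poly_act -big_split /=; apply: eq_bigr => w _; rewrite wactD. Qed.

Lemma pact_cons w p x : pact (w :: p) x = wact w x + pact p x.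
Proof. by rewrite /poly_act big_cons. Qed.

(* A matrix over R_+ is a list of entries (row, column, word). *)
Notation entry := (bool * bool * word)%type.
Definition entry_act (e : entry) v : V :=
  let x := wact e.2 (if e.1.2 then v.1 else v.2) in if e.1.1 then (x, 0) else (0, x).
Definition mx_act (l : seq entry) v : V := \sum_(e <- l) entry_act e v.

(** The matrices in M_2(R_{>= j}), seen as operators on [V]. *)
Definition ops j T := exists l, all (fun e : entry => j <= size e.2)%N l /\ T = mx_act l.

Lemma entry_actD e : is_additive (entry_act e).
Proof.
case: e => [[r c] w] v v'; rewrite /entry_act /=.
by case: c; case: r; rewrite /= wactD; congr (_, _); rewrite /= addr0.
Qed.

Lemma entry_act_comp r s r' s' u w v :
  entry_act (r, s, u) (entry_act (r', s', w) v) =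
  if s == r' then entry_act (r, s', u ++ w) v else 0.
Proof.
rewrite /entry_act /= wact_cat.
by case: r r' s => [] [] [] //=; rewrite wact0.
Qed.

Lemma mx_act_cat l l' v : mx_act (l ++ l') v = mx_act l v + mx_act l' v.
Proof. by rewrite /mx_act big_cat. Qed.

Lemma mx_actD l : is_additive (mx_act l).
Proof. by move=> v v'; rewrite /mx_act -big_split; apply: eq_bigr => e _; exact: entry_actD. Qed.

Lemma opsD j T : ops j T -> is_additive T.
Proof. by move=> [l [_ ->]]; exact: mx_actD. Qed.

Lemma additive0 T : is_additive T -> T 0 = 0.
Proof. by move=> TD; apply: (addrI (T 0)); rewrite -TD !addr0. Qed.

Lemma ops0 j : ops j (fun=> 0).
Proof. by exists [::]; split=> //; apply/funext => v; rewrite /mx_act big_nil. Qed.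

Lemma ops_add j S T : ops j S -> ops j T -> ops j (fun v => S v + T v).
Proof.
move=> [l [lj ->]] [l' [l'j ->]]; exists (l ++ l'); rewrite all_cat lj l'j; split=> //.
by apply/funext => v; rewrite mx_act_cat.
Qed.

Lemma opsW i j T : (i <= j)%N -> ops j T -> ops i T.
Proof.
move=> ij [l [lj ->]]; exists l; split=> //.
by apply: sub_all lj => e; exact: leq_trans.
Qed.

Lemma ops_entry j e : (j <= size e.2)%N -> ops j (entry_act e).
Proof.
by move=> je; exists [:: e]; rewrite /= je; split=> //; apply/funext => v; rewrite /mx_act big_seq1.
Qed.

Lemma ops_comp i j S T : ops i S -> ops j T -> ops (i + j) (S \o T).
Proof.
move=> [l [li ->]] [l' [l'j ->]]; elim: l li => [_|e l IHl /= /andP [ie /IHl opl]].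
  by have := ops0 (i + j); congr ops; apply/funext => v; rewrite /= /mx_act big_nil.
suff ope : ops (i + j) (entry_act e \o mx_act l').
  by have := ops_add ope opl; congr ops; apply/funext => v; rewrite /= /mx_act big_cons.
elim: l' l'j {l IHl opl} => [_|e' l' IHl /= /andP [je' /IHl opl]].
  have := ops0 (i + j); congr ops; apply/funext => v; rewrite /= /mx_act big_nil.
  by rewrite additive0 //; exact: entry_actD.
suff ope : ops (i + j) (entry_act e \o entry_act e').
  have := ops_add ope opl; congr ops; apply/funext => v.
  by rewrite /= /mx_act big_cons entry_actD.
case: e e' ie je' {opl IHl} => [[r s] u] [[r' s'] w] /= iu jw.
have [E|E] := eqVneq s r'.
  have : ops (i + j) (entry_act (r, s', u ++ w)) by apply: ops_entry; rewrite /= size_cat leq_add.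
  by congr ops; apply/funext => v; rewrite /= entry_act_comp E eqxx.
have := ops0 (i + j); congr ops; apply/funext => v.
by rewrite /= entry_act_comp (negPf E).
Qed.

Definition coef (l : seq entry) r s : poly := [seq e.2 | e <- l & (e.1.1 == r) && (e.1.2 == s)].

Lemma mx_act_coef l v : mx_act l v =
  (pact (coef l true true) v.1 + pact (coef l true false) v.2,
   pact (coef l false true) v.1 + pact (coef l false false) v.2).
Proof.
elim: l => [|[[r s] w] l IHl]; first by rewrite /mx_act /poly_act /coef !big_nil !addr0.
rewrite /mx_act big_cons -/(mx_act l v) IHl /entry_act /coef /=.
by case: r; case: s => /=; rewrite pact_cons; congr (_, _); rewrite /= ?add0r //;
  first [exact: addrA | exact: addrCA].
Qed.

(* Each matrix has four entries, so k matrices have at most 4 k coefficients. *)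
Lemma ops_nil j k (T : 'I_k -> V -> V) : (0 < j)%N -> (4 * k <= 4 ^ j)%N ->
    (forall i, ops j (T i)) ->
  exists N, forall s : seq 'I_k, (N <= size s)%N -> forall v, foldr T v s = 0.
Proof.
move=> j0 kj /choice [l lP].
pose fs := [seq coef (l rs.1) rs.2.1 rs.2.2 | rs <- enum {: 'I_k * (bool * bool)}].
have [||N NP] := @em_nil M j fs j0.
- by rewrite size_map -cardT !card_prod card_bool card_ord; lia.
- apply/allP => _ /mapP [[i [r s]] _ ->]; apply/allP => _ /mapP [e /= + ->].
  by rewrite mem_filter => /andP [_]; apply: (allP (lP i).1).
(* [Y n x]: every product of [n] coefficients kills [x]. Each application of some [T i] uses up one
   coefficient. *)
pose Y n (x : W) := forall gs, size gs = n -> {subset gs <= fs} -> foldr pact x gs = 0.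
have fold0 gs : foldr pact (0 : W) gs = 0.
  by elim: gs => //= g gs ->; apply: (addrI (pact g 0)); rewrite -pactD !addr0.
have YD n x y : Y n x -> Y n y -> Y n (x + y).
  move=> Yx Yy gs sgs gsf; rewrite -[RHS]addr0 -{1}(Yx gs sgs gsf) -(Yy gs sgs gsf).
  by elim: (gs) => //= g gs' ->; rewrite pactD.
have Yf n x i r s : Y n.+1 x -> Y n (pact (coef (l i) r s) x).
  move=> Yx gs sgs gsf; rewrite -foldr_rcons; apply: Yx; first by rewrite size_rcons sgs.
  move=> g; rewrite mem_rcons inE => /orP [/eqP ->|/gsf //].
  by apply/mapP; exists (i, (r, s)); rewrite ?mem_enum.
have Ys n s v : Y (size s + n)%N v.1 -> Y (size s + n)%N v.2 ->
    Y n (foldr T v s).1 /\ Y n (foldr T v s).2.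
  elim: s n => //= i s IHs n; rewrite !addSnnS => Y1 Y2.
  have [F1 F2] := IHs n.+1 Y1 Y2; rewrite (lP i).2 mx_act_coef /=.
  by split; apply: YD; exact: Yf.
have Y0 x : Y 0 x -> x = 0 by move/(_ [::]); apply.
exists N => s Ns v.
have YN x : Y (size s + 0)%N x.
  move=> gs; rewrite addn0 => sgs gsf; rewrite -(cat_take_drop (size s - N) gs) foldr_cat.
  by rewrite (NP (drop _ gs)) ?fold0 // => [|g /mem_drop /gsf //]; rewrite size_drop sgs subKn.
have [/Y0 E1 /Y0 E2] := Ys 0%N s v (YN _) (YN _).
by rewrite [foldr _ _ _]surjective_pairing E1 E2.
Qed.

(* The congruence subgroup 1 + M_2(R_{>= j}). *)
Definition gam j (g : V -> V) := exists2 T, ops j T & g = (fun v => v + T v).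

Lemma gamW i j g : (i <= j)%N -> gam j g -> gam i g.
Proof. by move=> ij [T Tj ->]; exists T => //; exact: opsW Tj. Qed.

Lemma gamD j g : gam j g -> is_additive g.
Proof. by move=> [T /opsD TD ->] x y; rewrite TD addrACA. Qed.

Lemma gam_id j : gam j id.
Proof. by exists (fun=> 0); [exact: ops0|apply/funext => v; rewrite addr0]. Qed.

Lemma gam_comp j g h : gam j g -> gam j h -> gam j (g \o h).
Proof.
move=> [S Sj ->] [T Tj ->]; exists (fun v => T v + (S v + (S \o T) v)).
  by apply: ops_add => //; apply: ops_add => //; apply: opsW (leq_addr _ _) (ops_comp Sj Tj).
by apply/funext => v /=; rewrite (opsD Sj) -addrA.
Qed.

Lemma gam_nil j T : (0 < j)%N -> ops j T -> exists N, forall n v, (N <= n)%N -> iter n T v = 0.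
Proof.
move=> j0 Tj; have [|N NP] := @ops_nil j 1 (fun=> T) j0 _ (fun=> Tj).
  by rewrite muln1 -{1}[4%N]expn1 leq_exp2l.
exists N => n v Nn; rewrite -(NP (nseq n ord0) _ v) ?size_nseq //.
by elim: n {Nn} => //= n ->.
Qed.

(* In characteristic 2, (1 + T)^(2^k) = 1 + T^(2^k). *)
Lemma iter_gam j T k v : ops j T ->
  iter (2 ^ k) (fun x => x + T x) v = v + iter (2 ^ k) T v.
Proof.
move=> /opsD TD; have iterD_ n x y : iter n T (x + y) = iter n T x + iter n T y.
  by elim: n => //= n ->.
elim: k v => // k IHk v; rewrite expnS mul2n -addnn !iterD !IHk iterD_ addrA.
by rewrite -[_ + _ + iter _ _ v]addrA addxxV addr0.
Qed.

(** By nilpotency and [iter_gam], the 2^N-th power of [g] is the identity, so the inverse is a power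
    of [g]. *)
Lemma gam_inv j g : (0 < j)%N -> gam j g -> exists h, [/\ gam j h, cancel g h & cancel h g].
Proof.
move=> j0 gj; have [T Tj gE] := gj; have [N NP] := gam_nil j0 Tj.
have itg n : gam j (iter n g).
  by elim: n => [|n IHn]; [exact: gam_id|exact: gam_comp].
have gK v : iter (2 ^ N) g v = v.
  by rewrite gE (iter_gam _ _ Tj) NP ?addr0 // ltnW // ltn_expl.
exists (iter (2 ^ N).-1 g); split=> // v.
  by rewrite -iterSr prednK ?expn_gt0.
by rewrite -iterS prednK ?expn_gt0.
Qed.

Lemma gam_group j : (0 < j)%N -> is_group (gam j).
Proof.
by move=> j0; split; [exact: gam_id|exact: gam_comp|move=> g; exact: gam_inv].
Qed.

Lemma gam_square j g : (0 < j)%N -> gam j g -> gam j.+1 (g \o g).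
Proof.
move=> j0 [T Tj ->]; exists (T \o T).
  by apply: opsW (ops_comp Tj Tj); rewrite -addn1 leq_add2l.
by apply/funext => v /=; rewrite (opsD Tj) addrA -[_ + _ + T v]addrA addxxV addr0.
Qed.

(** One has [g h = h g + D] with [D = S T + T S] of degree at least [j + j], which exceeds [j].
    Together with [gam_square], [gam j] over [gam j.+1] is elementary abelian. *)
Lemma gam_comm j g h g' h' : (0 < j)%N -> gam j g -> gam j h -> gam j g' -> gam j h' ->
  cancel g' g -> cancel h' h -> gam j.+1 (g \o h \o g' \o h').
Proof.
move=> j0 [S Sj gE] [T Tj hE] g'j h'j g'K h'K.
pose D v := (S \o T) v + (T \o S) v.
have D2j : ops (j + j) D by apply: ops_add; exact: ops_comp.
have [R Rj RE] := gam_comp g'j h'j.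
have ghE w : g (h w) = h (g w) + D w.
  rewrite gE hE /D /= (opsD Sj) (opsD Tj) -!addrA; congr (_ + _).
  rewrite addrCA; congr (_ + _); congr (_ + _).
  by rewrite addrCA addxxV addr0.
exists (fun v => D v + (D \o R) v).
  apply: (@opsW _ (j + j)); first by rewrite -addn1 leq_add2l.
  by apply: ops_add => //; apply: opsW (leq_addr j _) (ops_comp D2j Rj).
apply/funext => v; have := congr1 (fun f => f v) RE => /= RE'.
by rewrite ghE g'K h'K RE' (opsD D2j).
Qed.

Section Layer.
Variables (j n : nat).
Hypothesis j0 : (0 < j)%N.
Implicit Types (P Q : (V -> V) -> Prop).

Let between P := [/\ is_group P, forall g, gam j.+1 g -> P g & forall g, P g -> gam j g].
Let elem (e : entry) v := v + entry_act e v.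

Lemma gam_elem e : size e.2 = j -> gam j (elem e).
Proof. by move=> ej; exists (entry_act e) => //; apply: ops_entry; rewrite ej. Qed.

(** Commutators and squares of [gam j] lie in [gam j.+1], hence in [P]; so [u] normalizes [P] and
    has its square there. *)
Lemma ext_between P u : between P -> gam j u -> between (ext P u).
Proof.
move=> [PG Pge Ple] uj; have [u' [u'j uK u'K]] := gam_inv j0 uj.
have conj a b k : gam j a -> gam j b -> cancel a b -> cancel b a -> P k -> P (a \o k \o b).
  move=> aj bj aK bK Pk; have [k' [Pk' kK k'K]] := isg_inv PG Pk.
  have c := gam_comm j0 aj (Ple _ Pk) bj (Ple _ Pk') bK k'K.
  have := isg_comp PG (Pge _ c) Pk; congr P; apply/funext => v /=.
  by rewrite kK.
split.
- apply: (@ext_group _ P u u') => //; try by apply/Pge/gam_square.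
  by move=> k Pk; split; exact: conj.
- by move=> g /Pge; exact: ext_sub.
- by move=> _ [k [/Ple kj [->|->]]] //; exact: gam_comp.
Qed.

(** Induction on the number of entries of degree exactly [j]: 1 + e + L = (1 + e)(1 + (1 + e)^-1 L),
    where passing from L to (1 + e)^-1 L only adds entries of degree at least [j + j]. *)
Lemma gam_generated Q : is_group Q -> (forall g, gam j.+1 g -> Q g) ->
  (forall e, size e.2 = j -> Q (elem e)) -> forall g, gam j g -> Q g.
Proof.
move=> QG Qge Qe _ [_ [l [lj ->]] ->].
have [m] := ubnP (count (fun e : entry => size e.2 == j) l).
elim: m l lj => // m IHm l lj lm.
have [/hasP [e el /eqP ej]|noe] := boolP (has (fun e : entry => size e.2 == j) l); last first.
  apply: Qge; exists (mx_act l) => //; exists l; split=> //.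
  apply/allP => e el; rewrite ltn_neqAle (allP lj) // andbT eq_sym.
  by apply: contraNneq noe => ej; apply/hasP; exists e => //; apply/eqP.
have lE v : mx_act l v = entry_act e v + mx_act (rem e l) v by rewrite /mx_act (big_rem e).
have rj : all (fun e : entry => j <= size e.2)%N (rem e l).
  by apply/allP => e' /mem_rem /(allP lj).
have [h' [[_ [l' [l'j ->]] h'E] eK h'K]] := gam_inv j0 (gam_elem ej).
have [l2 [l2j l2E]] : ops (j + j) (mx_act l' \o mx_act (rem e l)).
  by apply: ops_comp; [exists l'|exists (rem e l)].
have Qh : Q (fun v => v + mx_act (rem e l ++ l2) v).
  apply: IHm.
    rewrite all_cat rj; apply: sub_all l2j => e' /=; exact: leq_trans (leq_addr _ _).
  rewrite count_cat (eq_in_count (a2 := pred0) (s := l2)) ?count_pred0 ?addn0; last first.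
    by move=> e' /(allP l2j) /= le; apply/eqP => ej'; move: le; have := j0; rewrite ej'; lia.
  move: lm; rewrite (permP (perm_to_rem el)) /= ej eqxx ltnS; exact: leq_ltn_trans.
have := isg_comp QG (Qe e ej) Qh; congr Q; apply/funext => v /=.
rewrite mx_act_cat -l2E /= lE.
have -> : v + (mx_act (rem e l) v + mx_act l' (mx_act (rem e l) v)) = h' (elem e v + mx_act (rem e l) v).
  have h'D : is_additive h' by apply: (@gamD j); exists (mx_act l') => //; exists l'.
  by rewrite h'D eK h'E.
by rewrite -/(elem e _) h'K addrA.
Qed.

(** The [elem e] are adjoined one at a time with index at most two, so [small_ext] carries smallness
    from the top group down to [P]. *)
Lemma small_exts (es : seq entry) P : all (fun e : entry => size e.2 == j) es -> between P ->
  let Q := foldl (fun P e => ext P (elem e)) P es in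
  [/\ between Q, forall g, P g -> Q g, forall e, e \in es -> Q (elem e) &
      small n Q -> small n P \/ in_range n].
Proof.
elim: es P => [|e es IHes] P /=; first by move=> _ bP; split=> //; left.
move=> /andP [/eqP ej esj] bP; have bE := ext_between bP (gam_elem ej).
have [bQ EQ Qes sm] := IHes _ esj bE; have [PG _ _] := bP; have [EG _ _] := bE.
split=> //.
- by move=> g Pg; apply: EQ; exact: ext_sub.
- move=> e'; rewrite inE => /orP [/eqP ->|/Qes //]; apply/EQ/ext_self; exact: isg_id.
- by move=> /sm [/(small_ext PG EG)|]; [|right].
Qed.

Lemma small_layer : small n (gam j) -> small n (gam j.+1) \/ in_range n.
Proof.
pose es : seq entry := [seq (rc, tval w) | rc <- enum {: bool * bool}, w <- enum {: j.-tuple letter}].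
have esj : all (fun e : entry => size e.2 == j) es.
  by apply/allP => _ /allpairsP [[rc w] /= [_ _ ->]]; rewrite size_tuple.
have b0 : between (gam j.+1).
  by split=> //; [exact: gam_group|move=> g; exact: gamW].
have [[QG Qge Qle] _ Qes sm] := small_exts esj b0.
rewrite (_ : gam j = foldl (fun P e => ext P (elem e)) (gam j.+1) es) //.
apply/funext => g; apply/propext; split; last exact: Qle.
apply: gam_generated => // -[rc w] /= /eqP wj; apply: Qes.
by apply/allpairsP; exists (rc, Tuple wj); rewrite !mem_enum.
Qed.
End Layer.
End MatrixGroups.

(** * Lower and upper bounds for the congruence subgroups *)

Section TarskiBounds.
Variable M : expanding_module.
Notation W := (em_space M).
Notation V := (W * W)%type.
Notation wact := (word_act (@em_act M)).
Notation deg := (@em_deg M).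
Local Notation gamma j := (@gam M j).

(* The group generated by 1 + T_i, i < k, lies in the span over F_2 of the
   finitely many nonzero products of the T_i. *)
Lemma finite_span k (T : 'I_k -> V -> V) N :
    (forall i, is_additive (T i)) ->
    (forall s : seq 'I_k, (N <= size s)%N -> forall v, foldr T v s = 0) ->
  forall A : seq (seq 'I_k), exists c : {ffun N.-bseq 'I_k -> bool},
    forall v, \sum_(s <- A) foldr T v s = \sum_(s | c s) foldr T v s.
Proof.
move=> TD TN; elim=> [|s A [c cP]].
  by exists [ffun=> false] => v; rewrite big_nil big_pred0 // => s; rewrite ffunE.
have [sN|Ns] := leqP (size s) N; last first.
  by exists c => v; rewrite big_cons cP TN ?add0r // ltnW.
pose t : N.-bseq 'I_k := Bseq sN.
(* In characteristic 2, adding a product toggles its coefficient. *)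
exists [ffun x => (x == t) (+) c x] => v; rewrite big_cons cP.
rewrite [RHS](bigID (pred1 t)) [X in _ + X = _](bigID (pred1 t)) /= addrA; congr (_ + _); last first.
  by apply: eq_bigl => x; rewrite ffunE; case: eqP; rewrite ?andbF ?andbT.
have [ct|nct] := boolP (c t).
  rewrite (big_pred1 t) => [|x]; last by rewrite /=; case: eqP => [->|]; rewrite ?andbF ?andbT.
  rewrite addxxV big_pred0 // => x; rewrite ffunE; case: eqP => [->|]; rewrite ?andbF ?andbT //.
  by rewrite ct.
rewrite big_pred0 ?addr0 => [|x]; last by case: eqP => [->|]; rewrite ?andbF ?andbT // (negPf nct).
by rewrite (big_pred1 t) // => x; rewrite ffunE /=; case: eqP => [->|]; rewrite ?andbF ?andbT // (negPf nct).
Qed.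

(** The group elements that are sums of products of the [T i] form a finite set, contain the
    identity and are stable under right multiplication by each 1 + T_i. *)
Lemma gam_paradox_size j k (G : is_group (gamma j)) m : (0 < j)%N -> (4 * k <= 4 ^ j)%N ->
  paradox (fgroup G) m -> (k < m true + m false)%N.
Proof.
move=> j0 kj; apply: paradox_size_gt => S Sk.
pose g (i : 'I_(size S)) := List.nth i S (gone _).
have /choice [T TP] : forall i : 'I_(size S), exists T, ops j T /\ sval (g i) = (fun v => v + T v).
  by move=> i; have [T Tj E] := svalP (g i); exists T.
have TD i : is_additive (T i) by exact: opsD (TP i).1.
have [||N NP] := @ops_nil M j (size S) T j0.
- by apply: leq_trans kj; rewrite leq_mul2l Sk.
- by move=> i; exact: (TP i).1.
have span := finite_span TD NP.
pose F (c : {ffun N.-bseq 'I_(size S) -> bool}) v := \sum_(s | c s) foldr T v s.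
(* A sum [F c] may fail to lie in the group; [pick] keeps it only if it does. *)
pose pick c : seq (fgroup G) :=
  if pselect (exists x : fgroup G, sval x = F c) is left ex then [:: projT1 (cid ex)] else [::].
pose K := List.flat_map pick (enum {: {ffun N.-bseq 'I_(size S) -> bool}}).
have KP x : List.In x K <-> exists c, sval x = F c.
  rewrite /K List.in_flat_map; split=> [[c [_]]|[c xc]].
    rewrite /pick; case: pselect => //= ex [<-|//]; exists c; exact: projT2 (cid ex).
  exists c; split.
    have : c \in enum {: {ffun N.-bseq 'I_(size S) -> bool}} by rewrite mem_enum.
    by elim: (enum _) => //= a s IHs; rewrite inE => /orP [/eqP ->|/IHs]; [left|right].
  rewrite /pick; case: pselect => [ex|[]]; last by exists x.
  by left; apply: fgroup_eq => v; rewrite (projT2 (cid ex)) xc.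
exists K; split.
  have [c cP] := span [:: [::]].
  have : List.In (gone (fgroup G)) K.
    by apply/KP; exists c; apply/funext => v; rewrite /F -cP big_seq1.
  by case: K {KP}.
move=> x t /KP [c xc] tS; apply/KP.
have [i [iS <-]] := List.In_nth _ _ (gone _) tS.
have iS' : (i < size S)%N by apply/ltP.
have giE v : sval (List.nth i S (gone (fgroup G))) v = v + T (Ordinal iS') v.
  by rewrite -[List.nth _ _ _]/(g (Ordinal iS')) (TP _).2.
pose A := [seq val s | s <- enum [pred s | c s]].
(* Since x (1 + T_i) = x + x T_i, the new products are the old ones with [i] appended. *)
have [c' c'P] := span (A ++ [seq rcons s (Ordinal iS') | s <- A]).
exists c'; apply/funext => v; rewrite /F -c'P big_cat /= !big_map !big_enum /=.
rewrite xc giE /F -big_split /=; apply: eq_bigr => s _.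
rewrite foldr_rcons; elim: (val s) => //= a l ->; exact: TD.
Qed.

Lemma deg_word n (x : W) : x <> 0 -> exists w : n.-tuple letter, deg (wact w x) = (deg x + n)%N.
Proof.
move=> x0; elim: n => [|n [w wE]]; first by exists [tuple]; rewrite addn0.
have [|i iE] := @em_deg_act M (wact w x); last by exists [tuple of i :: w]; rewrite /= iE wE addnS.
by move=> wx0; apply: x0; apply: em_deg_eq0; move: wE; rewrite wx0 em_deg0; lia.
Qed.

Lemma deg_addl (x y : W) : (deg x < deg y)%N -> deg (x + y) = deg y.
Proof.
move=> xy; apply/eqP; rewrite eqn_leq; apply/andP; split.
  by apply: leq_trans (em_degD _ _) _; rewrite geq_max leqnn ltnW.
have := em_degD x (x + y); rewrite addrA em_addxx add0r leq_max => /orP [|//].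
by rewrite leqNgt xy.
Qed.

(** A row ([true] for the first coordinate) and a word of length 1 or 2; [step] is the transvection
    adding that word times the other coordinate. *)
Let word_index (b : bool) := (bool * b.+1.-tuple letter)%type.
Let step b (i : word_index b) (v : V) : V :=
  v + entry_act ((i.1, ~~ i.1), tval i.2) v.

(* The larger component of (x, y) is the one that carries the information: from
   (x + w y, y) with deg (w y) = deg y + b + 1 > deg x one reads off first y,
   then b, and then w. *)
Lemma expanding_steps : exists t : forall b, V -> word_index b, forall b b' v v',
  v <> 0 -> v' <> 0 -> step (t b v) v = step (t b' v') v' -> b = b' /\ v = v'.
Proof.
have /choice [w wP] : forall bx : bool * W, exists w : seq letter, size w = bx.1.+1 /\
    (bx.2 <> 0 -> deg (wact w bx.2) = (deg bx.2 + bx.1.+1)%N).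
  move=> [b x] /=; have [->|x0] := pselect (x = 0).
    by exists (nseq b.+1 ord0); rewrite size_nseq; split.
  by have [w wE] := deg_word b.+1 x0; exists w; rewrite size_tuple.
pose side (v : V) := (deg v.1 <= deg v.2)%N.
pose big (v : V) := if side v then v.2 else v.1.
have wsize b x : size (w (b, x)) == (b : nat).+1 by rewrite (wP (b, x)).1.
pose t b v : word_index b := (side v, Tuple (wsize b (big v))).
have big0 v : v <> 0 -> big v <> 0.
  case: v => x y v0; rewrite /big /side /=; case: leqP => [xy y0|yx x0].
    apply: v0; rewrite y0 em_deg0 leqn0 in xy *.
    by rewrite (em_deg_eq0 (eqP xy)).
  by move: yx; rewrite x0 em_deg0.
have stepE b v : step (t b v) v = if side v then (v.1 + wact (w (b, big v)) (big v), v.2)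
    else (v.1, v.2 + wact (w (b, big v)) (big v)).
  rewrite /step /entry_act /t /=; case: v => x y; rewrite /big /=.
  by case: (side _); congr (_, _); rewrite /= addr0.
have degw b v : v <> 0 -> deg (wact (w (b, big v)) (big v)) = (deg (big v) + b.+1)%N.
  by move=> /big0 v0; exact: (wP (b, big v)).2.
have deg_step b v : v <> 0 ->
    if side v then deg (step (t b v) v).1 = (deg v.2 + b.+1)%N
    else deg (step (t b v) v).2 = (deg v.1 + b.+1)%N.
  move=> v0; have := degw b v v0; rewrite stepE /big; case: ifP => sv /= dw.
    by rewrite deg_addl ?dw // addnS ltnS (leq_trans sv) ?leq_addr.
  by rewrite deg_addl ?dw // addnS ltnS (leq_trans _ (leq_addr _ _)) // ltnW // ltnNge [(_ <= _)%N]sv.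
have sideE b v : v <> 0 ->
    side v = (deg (step (t b v) v).2 < deg (step (t b v) v).1)%N.
  move=> v0; have := deg_step b v v0; rewrite !stepE; case: (side v) => /= ->.
    by rewrite addnS ltnS leq_addr.
  by rewrite ltnNge addnS (leq_trans (leq_addr _ _) (leqnSn _)).
exists t => b b' v v' v0 v'0 E.
have sE : side v = side v' by rewrite (sideE b) // (sideE b') // E.
have := deg_step b' v' v'0; have := deg_step b v v0; rewrite -E -sE.
move: E; rewrite !stepE /big -sE.
have bool_inj (c c' : bool) n : (n + c.+1)%N = (n + c'.+1)%N -> c = c'.
  by move/addnI; case: c; case: c'.
case: (side v) => -[E1 E2] /= ->.
  rewrite E2 => /bool_inj bb'; split=> //; move: E1; rewrite E2 bb' => /addIr E1.
  by rewrite (surjective_pairing v) E1 E2 -surjective_pairing.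
rewrite E1 => /bool_inj bb'; split=> //; move: E2; rewrite E1 bb' => /addIr E2.
by rewrite (surjective_pairing v) E1 E2 -surjective_pairing.
Qed.

(** The map [xi], sending x to x^-1 (x0, 0), turns right multiplication by the inverse of a step
    into that step, so the paradox on nonzero pairs pulls back to the group. *)
Lemma gam1_paradox (G : is_group (gamma 1)) : exists m, paradox (fgroup G) m.
Proof.
have [t t_inj] := expanding_steps; have [x0 x0_neq0] := em_nontrivial M.
have stepP b (i : word_index b) : gamma 1 (step i).
  exists (entry_act ((i.1, ~~ i.1), tval i.2)) => //.
  by apply: ops_entry; rewrite /= size_tuple.
pose s b (i : word_index b) : fgroup G := ginv (fgroup G) (exist _ (step i) (stepP b i)).
pose xi (x : fgroup G) : V := sval (ginv (fgroup G) x) (x0, 0).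
have xi_neq0 x : xi x <> 0.
  move=> E; apply: x0_neq0; have := fgroupKV x (x0, 0); rewrite -/(xi x) E.
  have [T Tj ->] := svalP x; rewrite (additive0 (opsD Tj)) addr0.
  by move/(congr1 fst).
pose f b (x : fgroup G) := gmul (fgroup G) x (s b (t b (xi x))).
have xi_f b x : xi (f b x) = step (t b (xi x)) (xi x).
  by rewrite /xi /f ginvM ginvK.
exists (fun b => #|{: word_index b}|).
exists (fun b n => s b (nth (t b 0) (enum {: word_index b}) n)), f; split=> [b x|b b' x x' E].
  exists (index (t b (xi x)) (enum {: word_index b})); rewrite nth_index ?mem_enum //.
  by rewrite cardE index_mem mem_enum.
have [bb' xx'] : b = b' /\ xi x = xi x'.
  by apply: t_inj => //; rewrite -!xi_f E.
(* The translation depends only on [b] and [xi x], so it is now the same on both sides and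
   cancels. *)
split=> //; move: E; rewrite /f -bb' -xx'; exact: gmulIr.
Qed.
End TarskiBounds.

(** * Descending the chain of congruence subgroups *)

Lemma tarski_interpolation : exists N, forall n, (N <= n)%coq_nat -> in_range n.
Proof.
have G1 : is_group (@gam golod_module 1) by exact: gam_group.
(* The threshold exceeds the piece count of one paradox of [gam 1], which is therefore small for
   each such [n]. *)
have [m Pm] := gam1_paradox G1; exists (m true + m false).+1 => n /leP mn.
have layers j : small n (@gam golod_module j.+1) \/ in_range n.
  elim: j => [|j [sm|]]; [by left; exists G1, m|exact: small_layer|by right].
have [[G [m' [Pm' m'n]]]|//] := layers n.
(* At layer [n.+1] every paradox has more than [n] pieces, so smallness must have been lost earlier,
   with [in_range n] as the outcome. *)
have le4 : (4 * n <= 4 ^ n.+1)%N by rewrite expnS leq_mul2l; exact/ltnW/ltn_expl.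
by have := leq_ltn_trans (gam_paradox_size (ltn0Sn n) le4 Pm') m'n; rewrite ltnNge leqnSn.
Qed.

End TarskiNumbers.

Theorem theorem4p8 :
  exists N : nat, forall n : nat, (N <= n)%nat ->
    exists H : Group, non_amenable H /\
      exists t : nat, is_tarski_number H t /\ (n <= t)%nat /\ (t <= 2 * n)%nat.
Proof.
exact TarskiNumbers.tarski_interpolation.
Qed.
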